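(* Let $v(0)\in\mathcal N^*$ and for $n\ge1$ let $\lambda_n:[0,\infty)\to(0,\infty)$ be continuous with $\inf_t\lambda_n(t)>0$, and suppose $\lambda_n\to0$ uniformly on $[0,\infty)$. Let $v^n(t)$ be the solution of the subcritical equations with initial condition $v(0)$ and rate function $\lambda_n$, and let $v(t)$ be the solution of the critical equations with initial condition $v(0)$. Then $\lim_{n\to\infty}v^n_k(t)=v_k(t)$ for all $t\ge0$ and $k\ge1$, and $\Phi_n\to\Phi$ uniformly on $[0,\infty)$, where $\Phi_n(t)=m_0(0)-m^n_0(t)$ and $\Phi(t)=m_0(0)-m_0(t)$.
   Context: $\mathcal N$: sequences $v=(v_k)_{k\ge1}$ of nonnegative reals with $\sum_kv_k<\infty$; $\mathcal N^*$: those with finitely many nonzero terms; $m_0=\sum_kv_k$ (and $m_0(t)$, $m^n_0(t)$ for the corresponding time-dependent sequences). The subcritical equations with rate function $\lambda$ (continuous, bounded below by a positive constant): $v(t)\in\mathcal N$ and for all $k$, $v_k(t)=v_k(0)+\int_0^t\big(\tfrac k2\sum_{l=1}^{k-1}v_l(s)v_{k-l}(s)-kv_k(s)m_0(s)-\lambda(s)kv_k(s)\big)ds$, with $\Phi(t)=m_0(0)-m_0(t)$ satisfying $0\le\Phi(s)\le\Phi(t)<m_0(0)$ for $s\le t$. The critical equations are the same with $\lambda\equiv0$. Both have unique solutions. *)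

(* Defs.v *)
From Stdlib Require Import Reals.
From Coquelicot Require Import Coquelicot.
Open Scope R_scope.

(* A configuration is w : nat -> R, with w k = v_k for k >= 1 (w 0 is ignored). *)

Definition m0 (w : nat -> R) : R := Series (fun k => w (S k)).

(* sum_{l=1}^{k-1} v_l v_{k-l}  (empty, i.e. 0, for k = 1) *)
Definition conv (w : nat -> R) (k : nat) : R :=
  sum_n_m (fun l => w l * w (k - l)%nat) 1 (k - 1).

Definition in_N (w : nat -> R) : Prop :=
  (forall k, (1 <= k)%nat -> 0 <= w k) /\ ex_series (fun k => w (S k)).

Definition in_Nstar (w : nat -> R) : Prop :=
  (forall k, (1 <= k)%nat -> 0 <= w k) /\
  exists K : nat, forall k, (K < k)%nat -> w k = 0.

Definition Phi (v : R -> nat -> R) (t : R) : R := m0 (v 0) - m0 (v t).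

(* v is a solution on [0,oo) of the subcritical equations with rate function
   lam and initial condition v0 (critical equations: lam = 0). *)
Definition is_solution (lam : R -> R) (v0 : nat -> R) (v : R -> nat -> R) : Prop :=
  (forall t, 0 <= t -> in_N (v t)) /\
  (forall k, (1 <= k)%nat -> v 0 k = v0 k) /\
  (forall t k, 0 <= t -> (1 <= k)%nat ->
     is_RInt (fun s => INR k / 2 * conv (v s) k
                       - INR k * v s k * m0 (v s)
                       - lam s * INR k * v s k)
             0 t (v t k - v 0 k)) /\
  (forall s t, 0 <= s -> s <= t ->
     0 <= Phi v s /\ Phi v s <= Phi v t /\ Phi v t < m0 (v 0)).

Definition continuous_on_halfline (f : R -> R) : Prop :=
  forall t, 0 <= t ->
    filterlim f (within (fun s => 0 <= s) (locally t)) (locally (f t)).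

(* Main.v *)
(* Let G be the clock with G' = m0 + lambda, G(0) = 0.  Then w_k = v_k exp(k G)
   satisfies w_k' = (k/2) sum_l w_l w_(k-l), so w depends on v(0) only, and
   G' = lambda + sum_k w_k exp(-k G).  The right-hand side decreases in G, hence
   G <= G_n <= G + t sup(lambda_n): this yields v^n_k -> v_k and, since the mass is
   decreasing in the clock and a supremum of partial sums, m0^n <= m0 and
   m0^n(t) -> m0(t) pointwise.  Uniformity follows because masses are monotone, m0 is
   continuous and m0 -> 0 at infinity.

   For the last two facts, let F be the generating polynomial of v(0) and
   H_t(w) = F(exp(t w - G(t))) - w.  Following characteristics back to time 0 gives
   H_t >= 0 on [0, m0(t)) and H_t(m0(t)) <= 0.  At w = m0(t)/2 this bounds m0(t)^2 by
   4 m0(0)/t; and a jump of m0 at t would contradict the strict convexity of H_t.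

   Since m0 is not known to be continuous a priori, everything is done with right
   derivatives. *)

Require Import Defs.
From Stdlib Require Import Reals Lra Lia Classical Wf_nat.
From Coquelicot Require Import Coquelicot.
Open Scope R_scope.

(** * Right derivatives *)

(** Induction along the real line, through the supremum of the initial segments on which [P] holds:
    the first hypothesis reaches that supremum, the second passes beyond it. At [s = a] the premise
    of the first is vacuous, which provides the base case. *)
Lemma real_induction (P : R -> Prop) (a b : R) :
  (forall s, a <= s <= b -> (forall r, a <= r < s -> P r) -> P s) ->
  (forall s, a <= s < b -> (forall r, a <= r <= s -> P r) ->
     exists d, 0 < d /\ forall r, s < r < s + d -> P r) ->
  forall s, a <= s <= b -> P s.
Proof.
  intros Hcl Hext s0 Hs0.
  set (E := fun s => a <= s <= b /\ forall r, a <= r <= s -> P r).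
  assert (Ea : E a).
  { split; [lra|]. intros r Hr. apply Hcl; [lra|]. intros; lra. }
  destruct (completeness E) as [m [Hub Hlub]].
  { exists b. intros s [Hs _]. lra. }
  { exists a; exact Ea. }
  assert (Ham : a <= m) by (apply Hub, Ea).
  assert (Hmb : m <= b) by (apply Hlub; intros s [Hs _]; lra).
  assert (Hlt : forall r, a <= r < m -> P r).
  { intros r Hr. apply NNPP; intros Hn.
    assert (m <= r); [|lra]. apply Hlub. intros s [Hs Hs'].
    destruct (Rle_dec s r); [assumption|]. elim Hn. apply Hs'. lra. }
  assert (Hm : P m) by (apply Hcl; [lra|assumption]).
  assert (Hle : forall r, a <= r <= m -> P r).
  { intros r Hr. destruct (Req_dec r m); [subst; assumption|]. apply Hlt; lra. }
  destruct (Rlt_dec m b) as [Hlb|Hlb]; [|apply Hle; lra].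
  exfalso. destruct (Hext m) as [d [Hd Hd']]; [lra|assumption|].
  set (q := m + Rmin d (b - m) / 2).
  assert (0 < Rmin d (b - m)) by (apply Rmin_glb_lt; lra).
  pose proof (Rmin_l d (b - m)). pose proof (Rmin_r d (b - m)).
  assert (E q).
  { unfold q; split; [lra|]. intros r Hr.
    destruct (Rle_dec r m); [apply Hle; lra|apply Hd'; lra]. }
  assert (q <= m) by (apply Hub; assumption). unfold q in *; lra.
Qed.

Lemma continuous_Reps (f : R -> R) (x : R) :
  continuous f x <->
  forall eps, 0 < eps -> exists d, 0 < d /\
    forall y, Rabs (y - x) < d -> Rabs (f y - f x) < eps.
Proof.
  split.
  - intros H eps Heps.
    apply (proj1 (filterlim_locally _ _)) with (eps := mkposreal _ Heps) in H.
    destruct H as [d Hd]. exists d; split; [apply cond_pos|]. intros y Hy. apply Hd, Hy.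
  - intros H. apply filterlim_locally. intros eps.
    destruct (H eps (cond_pos eps)) as [d [Hd Hd']].
    exists (mkposreal d Hd). intros y Hy. apply Hd', Hy.
Qed.

(* Such a [g] can be continued arbitrarily to the left of [t], so this is the
   right derivative, with the two-sided calculus rules available for [g]. *)
Definition is_rderive (f : R -> R) (t l : R) : Prop :=
  exists g : R -> R, is_derive g t l /\ forall s, t <= s -> g s = f s.

Lemma is_rderive_val (f : R -> R) (t l l' : R) :
  is_rderive f t l -> l = l' -> is_rderive f t l'.
Proof. intros H <-; exact H. Qed.

Lemma is_rderive_ext (f g : R -> R) (t l : R) :
  (forall s, t <= s -> f s = g s) -> is_rderive f t l -> is_rderive g t l.
Proof.
  intros E [h [Hh Hf]]. exists h; split; [exact Hh|].
  intros s Hs. rewrite Hf by exact Hs. apply E, Hs.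
Qed.

Lemma is_rderive_const (c t : R) : is_rderive (fun _ => c) t 0.
Proof. exists (fun _ => c); split; [exact (is_derive_const c t)|reflexivity]. Qed.

Lemma is_rderive_id (t : R) : is_rderive (fun s => s) t 1.
Proof. exists (fun s => s); split; [exact (is_derive_id t)|reflexivity]. Qed.

Lemma is_rderive_plus (f g : R -> R) (t a b : R) :
  is_rderive f t a -> is_rderive g t b -> is_rderive (fun s => f s + g s) t (a + b).
Proof.
  intros [F [HF EF]] [G [HG EG]]. exists (fun s => F s + G s); split.
  - exact (is_derive_plus F G t a b HF HG).
  - intros s Hs. rewrite EF, EG; auto.
Qed.

Lemma is_rderive_mult (f g : R -> R) (t a b : R) :
  is_rderive f t a -> is_rderive g t b ->
  is_rderive (fun s => f s * g s) t (a * g t + f t * b).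
Proof.
  intros [F [HF EF]] [G [HG EG]]. exists (fun s => F s * G s); split.
  - rewrite <- EF, <- EG by lra.
    exact (is_derive_mult F G t a b HF HG Rmult_comm).
  - intros s Hs. rewrite EF, EG; auto.
Qed.

Lemma is_rderive_scal (c : R) (f : R -> R) (t a : R) :
  is_rderive f t a -> is_rderive (fun s => c * f s) t (c * a).
Proof.
  intros H. apply is_rderive_val with (0 * f t + c * a);
    [apply is_rderive_mult; [apply is_rderive_const|exact H]|ring].
Qed.

Lemma is_rderive_minus (f g : R -> R) (t a b : R) :
  is_rderive f t a -> is_rderive g t b -> is_rderive (fun s => f s - g s) t (a - b).
Proof.
  intros Hf Hg. apply is_rderive_val with (a + (-1) * b); [|ring].
  apply is_rderive_ext with (fun s => f s + (-1) * g s); [intros; ring|].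
  apply is_rderive_plus; [exact Hf|apply is_rderive_scal, Hg].
Qed.

Lemma is_rderive_comp (phi f : R -> R) (t a b : R) :
  is_derive phi (f t) b -> is_rderive f t a -> is_rderive (fun s => phi (f s)) t (a * b).
Proof.
  intros Hp [F [HF EF]]. exists (fun s => phi (F s)); split.
  - apply (is_derive_comp phi F t b a); [rewrite EF by lra; exact Hp|exact HF].
  - intros s Hs. rewrite EF; auto.
Qed.

Lemma is_rderive_exp (f : R -> R) (t a : R) :
  is_rderive f t a -> is_rderive (fun s => exp (f s)) t (a * exp (f t)).
Proof. intros H. apply is_rderive_comp; [apply is_derive_exp|exact H]. Qed.

Lemma is_rderive_pos (f : R -> R) (t l : R) :
  is_rderive f t l -> 0 < l ->
  exists d, 0 < d /\ forall s, t < s < t + d -> f t < f s.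
Proof.
  intros [g [Hg E]] Hl. apply is_derive_Reals in Hg.
  destruct (Hg l Hl) as [d Hd]. exists d; split; [apply cond_pos|].
  intros s Hs. specialize (Hd (s - t)).
  replace (t + (s - t)) with s in Hd by ring.
  rewrite (E s), (E t) in Hd by lra.
  assert (Hq : Rabs ((f s - f t) / (s - t) - l) < l).
  { apply Hd; [lra|]. rewrite Rabs_pos_eq; lra. }
  apply Rabs_def2 in Hq.
  assert (Hp : 0 < (f s - f t) / (s - t)) by lra.
  assert (0 < (f s - f t) / (s - t) * (s - t)) by (apply Rmult_lt_0_compat; lra).
  replace ((f s - f t) / (s - t) * (s - t)) with (f s - f t) in * by (field; lra).
  lra.
Qed.

(** Continuous induction: continuity carries the sign to limits from the left and past points where
    [f] is positive, while at a zero the positive right derivative pushes [f] up. *)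
Lemma stays_nonneg (f : R -> R) (a b : R) :
  (forall s, continuous f s) -> 0 <= f a ->
  (forall s, a <= s < b -> f s = 0 -> exists l, 0 < l /\ is_rderive f s l) ->
  forall s, a <= s <= b -> 0 <= f s.
Proof.
  intros Hc Ha Hd. apply real_induction.
  - intros s Hs Hr. destruct (Req_dec s a) as [->|Hsa]; [exact Ha|].
    apply Rnot_lt_le; intros Hneg.
    destruct (proj1 (continuous_Reps f s) (Hc s) (- f s)) as [d [Hd0 Hd1]]; [lra|].
    set (q := Rmax a (s - d / 2)).
    assert (a <= q) by apply Rmax_l. assert (s - d / 2 <= q) by apply Rmax_r.
    assert (q < s) by (unfold q; apply Rmax_lub_lt; lra).
    specialize (Hr q ltac:(lra)). specialize (Hd1 q).
    assert (Hq : Rabs (f q - f s) < - f s).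
    { apply Hd1. apply Rabs_def1; lra. }
    apply Rabs_def2 in Hq. lra.
  - intros s Hs Hr. assert (H0 : 0 <= f s) by (apply Hr; lra).
    destruct (Req_dec (f s) 0) as [Hz|Hz].
    + destruct (Hd s Hs Hz) as [l [Hl Hl']].
      destruct (is_rderive_pos f s l Hl' Hl) as [d [Hd0 Hd1]].
      exists d; split; [exact Hd0|]. intros r Hr'. specialize (Hd1 r Hr'). lra.
    + destruct (proj1 (continuous_Reps f s) (Hc s) (f s)) as [d [Hd0 Hd1]]; [lra|].
      exists d; split; [exact Hd0|]. intros r Hr'.
      specialize (Hd1 r ltac:(apply Rabs_def1; lra)). apply Rabs_def2 in Hd1. lra.
Qed.

Lemma continuous_Rlin (f : R -> R) (c k : R) (x : R) :
  continuous f x -> continuous (fun s => f s + (c + k * s)) x.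
Proof.
  intros H. apply (continuous_plus (V := R_NormedModule) f); [exact H|].
  apply (ex_derive_continuous (fun s : R => c + k * s)). auto_derive; auto.
Qed.

Lemma is_rderive_lin (f : R -> R) (c k t l : R) :
  is_rderive f t l -> is_rderive (fun s => f s + (c + k * s)) t (l + k).
Proof.
  intros H. apply is_rderive_plus; [exact H|].
  apply is_rderive_val with (0 + k * 1); [|ring].
  apply is_rderive_plus; [apply is_rderive_const|apply is_rderive_scal, is_rderive_id].
Qed.

(** A drift of slope [e > 0] makes the derivative strictly positive, and a small [e] suffices for a
    contradiction. The sign is required only where [f] is positive, which is all that is known along
    characteristics: for small [e] the barrier [f a - e * (s - a)] is positive, hence so is [f]
    wherever it touches it. *)
Lemma positive_growth (f : R -> R) (a b : R) :
  (forall s, continuous f s) -> a <= b -> 0 < f a ->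
  (forall s, a <= s < b -> 0 < f s -> exists l, 0 <= l /\ is_rderive f s l) ->
  f a <= f b.
Proof.
  intros Hc Hab Ha Hd.
  assert (H : forall e, 0 < e -> e * (b - a) < f a -> f a - e * (b - a) <= f b).
  { intros e He Heb.
    enough (0 <= f b + ((- f a - e * a) + e * b)) by lra.
    apply (stays_nonneg (fun s => f s + ((- f a - e * a) + e * s)) a b); try lra.
    - intros s. apply continuous_Rlin, Hc.
    - intros s Hs Hz.
      assert (0 < f s).
      { assert (e * (s - a) <= e * (b - a)) by (apply Rmult_le_compat_l; lra). nra. }
      destruct (Hd s Hs) as [l [Hl Hl']]; [assumption|].
      exists (l + e); split; [lra|]. apply is_rderive_lin, Hl'. }
  apply Rnot_lt_le; intros Hlt.
  set (m := Rmin (f a) (f a - f b)).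
  assert (0 < m) by (apply Rmin_glb_lt; lra).
  assert (m <= f a) by apply Rmin_l. assert (m <= f a - f b) by apply Rmin_r.
  (* The total drift is then at most [m / 2], less than [f a] and than the supposed drop
     [f a - f b]; the [1 +] covers [a = b]. *)
  set (e := m / (2 * (1 + (b - a)))).
  assert (He : 0 < e) by (apply Rdiv_lt_0_compat; lra).
  assert (Hem : e * (b - a) <= m / 2).
  { assert (e * (1 + (b - a)) = m / 2) by (unfold e; field; lra). nra. }
  specialize (H e He ltac:(lra)). lra.
Qed.

Lemma rderive_nonneg_le (f : R -> R) (a b : R) :
  (forall s, continuous f s) -> a <= b ->
  (forall s, a <= s < b -> exists l, 0 <= l /\ is_rderive f s l) -> f a <= f b.
Proof.
  intros Hc Hab Hd.
  (* Translating [f] to the value 1 at [a] meets the positivity requirement of [positive_growth]. *)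
  enough (f a + ((1 - f a) + 0 * a) <= f b + ((1 - f a) + 0 * b)) by lra.
  apply (positive_growth (fun s => f s + ((1 - f a) + 0 * s))); try lra.
  - intros s; apply continuous_Rlin, Hc.
  - intros s Hs _. destruct (Hd s Hs) as [l [Hl Hl']].
    exists (l + 0); split; [lra|]. apply is_rderive_lin, Hl'.
Qed.

(** The barrier [e * (1 + (s - a))] starts above [f a] and rises with slope [e]; [f] can touch it
    only where [f > 0], where its own slope is at most 0. Hence no [e > 0] allows a crossing. *)
Lemma stays_nonpos (f : R -> R) (a b : R) :
  (forall s, continuous f s) -> a <= b -> f a <= 0 ->
  (forall s, a <= s < b -> 0 < f s -> exists l, l <= 0 /\ is_rderive f s l) ->
  f b <= 0.
Proof.
  intros Hc Hab Ha Hd.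
  assert (H : forall e, 0 < e -> f b <= e * (1 + (b - a))).
  { intros e He.
    enough (0 <= (-1) * f b + ((e - e * a) + e * b)) by lra.
    apply (stays_nonneg (fun s => (-1) * f s + ((e - e * a) + e * s)) a b); try lra.
    - intros s. apply (continuous_Rlin (fun s => (-1) * f s)).
      apply (continuous_scal_r (V := R_NormedModule) (-1) f), Hc.
    - intros s Hs Hz.
      destruct (Hd s Hs) as [l [Hl Hl']]; [nra|].
      exists ((-1) * l + e); split; [lra|].
      apply (is_rderive_lin (fun s => (-1) * f s)), is_rderive_scal, Hl'. }
  apply Rnot_lt_le; intros Hlt.
  specialize (H (f b / (2 * (1 + (b - a)))) ltac:(apply Rdiv_lt_0_compat; lra)).
  replace (f b / (2 * (1 + (b - a))) * (1 + (b - a))) with (f b / 2) in H by (field; lra).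
  lra.
Qed.

(** * Finite sums and convolutions *)

Fixpoint psum (a : nat -> R) (n : nat) : R :=
  match n with O => 0 | S m => psum a m + a (S m) end.

Lemma psum_ext (a b : nat -> R) (n : nat) :
  (forall k, (1 <= k <= n)%nat -> a k = b k) -> psum a n = psum b n.
Proof.
  induction n as [|n IH]; intros H; simpl; [reflexivity|].
  rewrite IH, (H (S n)); [reflexivity|lia|intros; apply H; lia].
Qed.

Lemma psum_le (a b : nat -> R) (n : nat) :
  (forall k, (1 <= k <= n)%nat -> a k <= b k) -> psum a n <= psum b n.
Proof.
  induction n as [|n IH]; intros H; simpl; [lra|].
  apply Rplus_le_compat; [apply IH; intros|]; apply H; lia.
Qed.

Lemma psum_plus (a b : nat -> R) (n : nat) :
  psum (fun k => a k + b k) n = psum a n + psum b n.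
Proof. induction n as [|n IH]; simpl; [ring|rewrite IH; ring]. Qed.

Lemma psum_scal (c : R) (a : nat -> R) (n : nat) :
  psum (fun k => c * a k) n = c * psum a n.
Proof. induction n as [|n IH]; simpl; [ring|rewrite IH; ring]. Qed.

Lemma psum_const (c : R) (n : nat) : psum (fun _ => c) n = INR n * c.
Proof. induction n as [|n IH]; [simpl; ring|]. rewrite S_INR; simpl; rewrite IH; ring. Qed.

Lemma psum_zero (n : nat) : psum (fun _ => 0) n = 0.
Proof. rewrite psum_const; ring. Qed.

Lemma psum_nonneg (a : nat -> R) (n : nat) :
  (forall k, (1 <= k <= n)%nat -> 0 <= a k) -> 0 <= psum a n.
Proof. intros H. rewrite <- (psum_zero n). apply psum_le, H. Qed.

Lemma psum_mono (a : nat -> R) (m n : nat) :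
  (forall k, (1 <= k <= n)%nat -> 0 <= a k) -> (m <= n)%nat -> psum a m <= psum a n.
Proof.
  intros H Hmn. induction Hmn as [|n Hmn IH]; simpl; [lra|].
  specialize (H (S n) ltac:(lia)) as H1.
  assert (psum a m <= psum a n) by (apply IH; intros; apply H; lia). lra.
Qed.

Lemma psum_Sl (a : nat -> R) (n : nat) :
  psum a (S n) = a 1%nat + psum (fun k => a (S k)) n.
Proof. induction n as [|n IH]; simpl in *; [ring|rewrite IH; ring]. Qed.

Lemma psum_rev (a : nat -> R) (n : nat) :
  psum (fun k => a (S n - k)%nat) n = psum a n.
Proof.
  revert a; induction n as [|n IH]; intros a; [reflexivity|].
  rewrite psum_Sl.
  rewrite (psum_ext _ (fun k => a (S n - k)%nat)) by (intros; f_equal; lia).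
  rewrite IH. simpl. ring.
Qed.

Lemma conv_psum (w : nat -> R) (k : nat) :
  conv w k = psum (fun l => w l * w (k - l)%nat) (k - 1).
Proof.
  unfold conv. generalize (k - 1)%nat as n. induction n as [|n IH].
  (* The range from 1 to 0 is empty, and [sum_n_m] returns its default 0. *)
  - exact (sum_n_m_zero (G := R_AbelianMonoid) _ 1 0 (Nat.lt_0_succ 0)).
  - rewrite sum_n_Sm by lia. rewrite IH. reflexivity.
Qed.

Lemma conv_ext (u w : nat -> R) (k : nat) :
  (forall l, (1 <= l < k)%nat -> u l = w l) -> conv u k = conv w k.
Proof.
  intros H. rewrite !conv_psum. apply psum_ext. intros l Hl.
  rewrite !H by lia. reflexivity.
Qed.

Lemma conv_nonneg (w : nat -> R) (k : nat) :
  (forall l, (1 <= l)%nat -> 0 <= w l) -> 0 <= conv w k.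
Proof.
  intros H. rewrite conv_psum. apply psum_nonneg. intros l Hl.
  apply Rmult_le_pos; apply H; lia.
Qed.

(** The exponential weights are multiplicative and the two sizes add up to [k]. *)
Lemma conv_tilt (w : nat -> R) (th : R) (k : nat) :
  conv (fun l => w l * exp (INR l * th)) k = conv w k * exp (INR k * th).
Proof.
  rewrite !conv_psum, Rmult_comm, <- psum_scal. apply psum_ext. intros l Hl.
  replace (INR k * th) with (INR l * th + INR (k - l) * th).
  - rewrite exp_plus. ring.
  - rewrite minus_INR by lia. ring.
Qed.

(* The factor [1/2] disappears by symmetry in [(l, k - l)]. *)
Lemma conv_half (u : nat -> R) (k : nat) :
  INR k / 2 * conv u k = psum (fun l => INR l * u l * u (k - l)%nat) (k - 1).
Proof.
  destruct k as [|n]; [rewrite conv_psum; simpl; field|].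
  rewrite conv_psum. replace (S n - 1)%nat with n by lia.
  set (A := psum (fun l => INR l * u l * u (S n - l)%nat) n).
  assert (HA : A = psum (fun l => INR (S n - l) * u (S n - l)%nat * u l) n).
  { unfold A. rewrite <- psum_rev. apply psum_ext. intros l Hl.
    replace (S n - (S n - l))%nat with l by lia. reflexivity. }
  enough (A + A = INR (S n) * psum (fun l => u l * u (S n - l)%nat) n) by lra.
  rewrite HA at 2. unfold A. rewrite <- psum_plus, <- psum_scal. apply psum_ext.
  intros l Hl. rewrite minus_INR by lia. ring.
Qed.

(** Summation by the first size [l]: among pairs with [l + j <= K], the second size [j] runs up to
    [K - l]. This shorter inner sum is the source of the truncation error in the characteristic
    estimates. *)
Lemma psum_conv (u : nat -> R) (K : nat) :
  psum (fun k => INR k / 2 * conv u k) K =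
  psum (fun l => INR l * u l * psum u (K - l)) K.
Proof.
  induction K as [|K IH]; [reflexivity|].
  cbn [psum]. rewrite IH, conv_half.
  replace (S K - 1)%nat with K by lia. replace (S K - S K)%nat with O by lia.
  simpl (psum u 0). rewrite Rmult_0_r, Rplus_0_r, <- psum_plus. apply psum_ext.
  intros l Hl. replace (S K - l)%nat with (S (K - l)) by lia.
  cbn [psum]. replace (S K - l)%nat with (S (K - l)) by lia. ring.
Qed.

(** * Partial sums and total mass *)

Lemma psum_sum_n (w : nat -> R) (n : nat) :
  sum_n (fun k => w (S k)) n = psum w (S n).
Proof.
  induction n as [|n IH]; [rewrite sum_O; simpl; ring|].
  rewrite sum_Sn, IH. reflexivity.
Qed.

Lemma psum_lim (w : nat -> R) : in_N w -> is_lim_seq (psum w) (m0 w).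
Proof.
  intros [_ H]. apply is_lim_seq_incr_1.
  apply is_lim_seq_ext with (sum_n (fun k => w (S k))).
  - intros n. apply psum_sum_n.
  - exact (Series_correct _ H).
Qed.

Lemma psum_le_m0 (w : nat -> R) (n : nat) : in_N w -> psum w n <= m0 w.
Proof.
  intros H. apply (is_lim_seq_incr_compare (psum w)); [apply psum_lim, H|].
  intros k. simpl. destruct H as [H _]. specialize (H (S k) ltac:(lia)). lra.
Qed.

Lemma m0_nonneg (w : nat -> R) : in_N w -> 0 <= m0 w.
Proof. intros H. exact (psum_le_m0 w 0 H). Qed.

Lemma le_m0 (w : nat -> R) (k : nat) : in_N w -> (1 <= k)%nat -> w k <= m0 w.
Proof.
  intros H Hk. apply Rle_trans with (psum w k); [|apply psum_le_m0, H].
  destruct k as [|k]; [lia|]. simpl.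
  assert (0 <= psum w k) by (apply psum_nonneg; intros; apply H; lia). lra.
Qed.

Lemma psum_near_m0 (w : nat -> R) (c : R) :
  in_N w -> c < m0 w -> exists K0, forall K, (K0 <= K)%nat -> c < psum w K.
Proof.
  intros H Hc. generalize (psum_lim w H). intros L. apply is_lim_seq_spec in L.
  assert (He : 0 < m0 w - c) by lra.
  destruct (L (mkposreal _ He)) as [N HN]. exists N. intros K HK.
  specialize (HN K HK). simpl in HN. apply Rabs_def2 in HN. lra.
Qed.

Lemma continuous_psum (f : R -> nat -> R) (n : nat) (s : R) :
  (forall k, (1 <= k <= n)%nat -> continuous (fun r => f r k) s) ->
  continuous (fun r => psum (f r) n) s.
Proof.
  induction n as [|n IH]; intros H; simpl; [apply continuous_const|].
  apply (continuous_plus (V := R_NormedModule) (fun r => psum (f r) n)).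
  - apply IH. intros; apply H; lia.
  - apply H; lia.
Qed.

Lemma is_rderive_psum (f : R -> nat -> R) (d : nat -> R) (n : nat) (t : R) :
  (forall k, (1 <= k <= n)%nat -> is_rderive (fun r => f r k) t (d k)) ->
  is_rderive (fun r => psum (f r) n) t (psum d n).
Proof.
  induction n as [|n IH]; intros H; simpl; [apply is_rderive_const|].
  apply is_rderive_plus; [apply IH; intros; apply H; lia|apply H; lia].
Qed.

(** * Right differentiability of solutions *)

(* Solutions extended by their initial value to negative times. Total mass is not
   known to be continuous yet, only the right derivatives exist everywhere. *)
Definition flow (lam : R -> R) (v : R -> nat -> R) : Prop :=
  (forall s, in_N (v s)) /\
  (forall k s, (1 <= k)%nat -> continuous (fun r => v r k) s) /\
  (forall s t, s <= t -> m0 (v t) <= m0 (v s)) /\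
  (forall t k, 0 <= t -> (1 <= k)%nat ->
     is_rderive (fun s => v s k) t
       (INR k / 2 * conv (v t) k - INR k * v t k * (m0 (v t) + lam t))).

Lemma continuous_Rmax_r (c x : R) : continuous (fun r => Rmax c r) x.
Proof.
  apply continuous_Reps. intros eps He. exists eps; split; [exact He|].
  intros y Hy. apply Rabs_def2 in Hy. apply Rabs_def1;
  unfold Rmax; destruct (Rle_dec c y), (Rle_dec c x); lra.
Qed.

Lemma continuous_shift (f : R -> R) (c x : R) :
  continuous (fun r => f r - c) x -> continuous f x.
Proof.
  intros H. apply (continuous_ext (fun r => (f r - c) + (c + 0 * r))).
  - intros r. simpl. ring.
  - apply (continuous_Rlin (fun r => f r - c)), H.
Qed.

Section Regularity.

Context (lam : R -> R) (v0 : nat -> R) (v : R -> nat -> R)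
  (Hlam : continuous_on_halfline lam) (Hsol : is_solution lam v0 v).

Let rate (k : nat) (s : R) : R :=
  INR k / 2 * conv (v s) k - INR k * v s k * m0 (v s) - lam s * INR k * v s k.

Lemma solution_mass_antitone (s t : R) : 0 <= s -> s <= t -> m0 (v t) <= m0 (v s).
Proof.
  intros Hs Hst. destruct Hsol as (_ & _ & _ & H).
  destruct (H s t Hs Hst) as (_ & H1 & _). unfold Phi in H1. lra.
Qed.

(** Each coefficient is a constant plus an indefinite integral, hence continuous. *)
Lemma solution_continuous (k : nat) (t : R) :
  (1 <= k)%nat -> continuous (fun r => v (Rmax 0 r) k) t.
Proof.
  intros Hk. destruct Hsol as (_ & _ & HI & _).
  apply continuous_shift with (v 0 k).
  (* A zero integrand at negative times reproduces the constant extension, so that the integral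
     exists on both sides of 0. *)
  apply (continuous_RInt_1 (V := R_NormedModule)
           (fun r => if Rlt_dec r 0 then 0 else rate k r) 0 t).
  exists (mkposreal 1 Rlt_0_1). intros s _.
  destruct (Rle_dec 0 s) as [Hs|Hs].
  - rewrite Rmax_right by exact Hs.
    apply (is_RInt_ext (rate k)); [|apply HI; assumption].
    intros x Hx. rewrite Rmin_left, Rmax_right in Hx by exact Hs.
    destruct (Rlt_dec x 0); [lra|reflexivity].
  - rewrite Rmax_left by lra.
    apply (is_RInt_ext (fun _ => 0)).
    + intros x Hx. rewrite Rmin_right, Rmax_left in Hx by lra.
      destruct (Rlt_dec x 0); [reflexivity|lra].
    + replace (v 0 k - v 0 k) with (scal (s - 0) (0 : R)).
      * apply (is_RInt_const (V := R_NormedModule)).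
      * unfold scal; simpl; unfold mult; simpl; ring.
Qed.

(* Mass is a supremum of continuous partial sums, hence lower semicontinuous. *)
Lemma solution_mass_right_continuous (t : R) :
  0 <= t -> continuous (fun r => m0 (v (Rmax t r))) t.
Proof.
  intros Ht. apply continuous_Reps. intros eps He.
  assert (HN : forall s, 0 <= s -> in_N (v s)) by apply Hsol.
  destruct (psum_near_m0 (v t) (m0 (v t) - eps / 2)) as [K HK]; [apply HN, Ht|lra|].
  specialize (HK K (le_n K)).
  assert (Hc : continuous (fun r => psum (v (Rmax 0 r)) K) t).
  { apply (continuous_psum (fun r => v (Rmax 0 r))). intros k Hk.
    apply solution_continuous; lia. }
  destruct (proj1 (continuous_Reps _ _) Hc (eps / 2)) as [d [Hd Hd']]; [lra|].
  exists d; split; [exact Hd|]. intros y Hy.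
  rewrite (Rmax_left t t) by lra.
  assert (Hty : t <= Rmax t y) by apply Rmax_l.
  assert (Hy' : Rabs (Rmax t y - t) < d).
  { apply Rabs_def2 in Hy. apply Rabs_def1;
    unfold Rmax; destruct (Rle_dec t y); lra. }
  specialize (Hd' _ Hy'). cbv beta in Hd'.
  rewrite (Rmax_right 0 (Rmax t y)), (Rmax_right 0 t) in Hd' by lra.
  apply Rabs_def2 in Hd'.
  pose proof (solution_mass_antitone t (Rmax t y) Ht Hty).
  pose proof (psum_le_m0 (v (Rmax t y)) K ltac:(apply HN; lra)).
  apply Rabs_def1; lra.
Qed.

(** Precomposition with [Rmax t] freezes a function to the left of [t], so right continuity becomes
    ordinary continuity at [t]. At this stage the mass is known to be continuous from the right
    only. *)
Lemma rate_right_continuous (k : nat) (t : R) :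
  (1 <= k)%nat -> 0 <= t -> continuous (fun r => rate k (Rmax t r)) t.
Proof.
  intros Hk Ht.
  assert (Hv : forall j, (1 <= j)%nat -> continuous (fun r => v (Rmax t r) j) t).
  { intros j Hj. apply (continuous_ext (fun r => v (Rmax 0 (Rmax t r)) j)).
    - intros r. rewrite (Rmax_right 0); [reflexivity|].
      apply Rle_trans with t; [exact Ht|apply Rmax_l].
    - apply (continuous_comp (fun r => Rmax t r) (fun r => v (Rmax 0 r) j)).
      + apply continuous_Rmax_r.
      + apply solution_continuous, Hj. }
  assert (Hl : continuous (fun r => lam (Rmax t r)) t).
  { apply continuous_Reps. intros eps He.
    destruct (proj1 (filterlim_locally _ _) (Hlam t Ht) (mkposreal eps He)) as [d Hd].
    exists d; split; [apply cond_pos|]. intros y Hy. rewrite (Rmax_left t t) by lra.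
    apply (Hd (Rmax t y)).
    - apply Rabs_def2 in Hy. apply Rabs_def1; unfold minus, plus, opp; simpl;
      unfold Rmax; destruct (Rle_dec t y); lra.
    - apply Rle_trans with t; [exact Ht|apply Rmax_l]. }
  unfold rate.
  apply (continuous_minus (V := R_NormedModule)
    (fun r => INR k / 2 * conv (v (Rmax t r)) k - INR k * v (Rmax t r) k * m0 (v (Rmax t r)))
    (fun r => lam (Rmax t r) * INR k * v (Rmax t r) k)).
  - apply (continuous_minus (V := R_NormedModule)
      (fun r => INR k / 2 * conv (v (Rmax t r)) k)
      (fun r => INR k * v (Rmax t r) k * m0 (v (Rmax t r)))).
    + apply (continuous_scal_r (V := R_NormedModule) (INR k / 2)
               (fun r => conv (v (Rmax t r)) k)).
      apply (continuous_ext (fun r =>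
        psum (fun l => v (Rmax t r) l * v (Rmax t r) (k - l)%nat) (k - 1))).
      { intros r. symmetry. apply conv_psum. }
      apply (continuous_psum (fun r l => v (Rmax t r) l * v (Rmax t r) (k - l)%nat)).
      intros l Hl'.
      apply (continuous_mult (K := R_AbsRing) (fun r => v (Rmax t r) l)); apply Hv; lia.
    + apply (continuous_mult (K := R_AbsRing) (fun r => INR k * v (Rmax t r) k)).
      * apply (continuous_scal_r (V := R_NormedModule) (INR k) (fun r => v (Rmax t r) k)).
        apply Hv, Hk.
      * apply solution_mass_right_continuous, Ht.
  - apply (continuous_mult (K := R_AbsRing) (fun r => lam (Rmax t r) * INR k)).
    + apply (continuous_scal_l (V := R_NormedModule) (fun r => lam (Rmax t r)) (INR k)).
      exact Hl.
    + apply Hv, Hk.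
Qed.

Lemma solution_rderive (k : nat) (t : R) :
  (1 <= k)%nat -> 0 <= t ->
  is_rderive (fun s => v (Rmax 0 s) k) t (rate k t).
Proof.
  intros Hk Ht. destruct Hsol as (_ & _ & HI & _).
  (* [I] integrates from [t] the rate frozen to the left of [t]: it is affine there and equals the
     true increment to the right. *)
  set (I := fun s => if Rlt_dec s t then (s - t) * rate k t else v s k - v t k).
  exists (fun s => I s + v t k). split.
  - replace (rate k t) with (plus (rate k (Rmax t t)) 0)
      by (rewrite Rmax_left by lra; apply Rplus_0_r).
    apply (is_derive_plus (V := R_NormedModule) I (fun _ => v t k));
      [|apply (is_derive_const (V := R_NormedModule))].
    apply (is_derive_RInt (V := R_NormedModule) (fun r => rate k (Rmax t r)) I t t).
    2: apply rate_right_continuous; assumption.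
    exists (mkposreal 1 Rlt_0_1). intros s _. unfold I.
    destruct (Rlt_dec s t) as [Hs|Hs].
    + apply (is_RInt_ext (fun _ => rate k t)).
      * intros x Hx. rewrite Rmin_right, Rmax_left in Hx by lra.
        rewrite Rmax_left by lra. reflexivity.
      * apply (is_RInt_const (V := R_NormedModule)).
    + apply (is_RInt_ext (rate k)).
      * intros x Hx. rewrite Rmin_left, Rmax_right in Hx by lra.
        rewrite Rmax_right by lra. reflexivity.
      * replace (v s k - v t k) with (plus (opp (v t k - v 0 k)) (v s k - v 0 k))
          by (unfold plus, opp; simpl; ring).
        apply (is_RInt_Chasles (V := R_NormedModule)) with 0.
        -- apply (is_RInt_swap (V := R_NormedModule)), HI; assumption.
        -- apply HI; [lra|assumption].
  - intros s Hs. unfold I. destruct (Rlt_dec s t); [lra|].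
    rewrite Rmax_right by lra. ring.
Qed.

Lemma solution_flow : flow lam (fun s => v (Rmax 0 s)).
Proof.
  split; [|split; [|split]].
  - intros s. apply Hsol, Rmax_l.
  - intros k s Hk. apply solution_continuous, Hk.
  - intros s t Hst. apply solution_mass_antitone; [apply Rmax_l|].
    apply Rle_max_compat_l, Hst.
  - intros t k Ht Hk. eapply is_rderive_val; [apply solution_rderive; assumption|].
    unfold rate. rewrite !(Rmax_right 0 t) by exact Ht. ring.
Qed.

End Regularity.

(** * The clock *)

Lemma exp_monotone (x y : R) : x <= y -> exp x <= exp y.
Proof. intros [H| ->]; [left; apply exp_increasing, H|right; reflexivity]. Qed.

(** The quadratic term keeps its form by [conv_tilt]; the tilt only adds [a] to the linear rate.
    Taking [a = m0 + lam] removes the linear term, a larger [a] makes the right-hand side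
    nonnegative, and a shift by a constant gives characteristics. *)
Lemma flow_tilt (lam : R -> R) (v : R -> nat -> R) (th : R -> R) (t a : R) (k : nat) :
  flow lam v -> 0 <= t -> (1 <= k)%nat -> is_rderive th t a ->
  is_rderive (fun s => v s k * exp (INR k * th s)) t
    (INR k / 2 * conv (fun l => v t l * exp (INR l * th t)) k
     + INR k * (a - (m0 (v t) + lam t)) * (v t k * exp (INR k * th t))).
Proof.
  intros (_ & _ & _ & Hd) Ht Hk Ha. rewrite conv_tilt.
  eapply is_rderive_val.
  - apply is_rderive_mult; [apply Hd; assumption|].
    apply is_rderive_exp, is_rderive_scal, Ha.
  - cbv beta. ring.
Qed.

Lemma continuous_tilt (v : R -> nat -> R) (th : R -> R) (s : R) (k : nat) :
  continuous (fun r => v r k) s -> continuous th s ->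
  continuous (fun r => v r k * exp (INR k * th r)) s.
Proof.
  intros Hv Hth. apply (continuous_mult (K := R_AbsRing) (fun r => v r k)); [exact Hv|].
  apply continuous_exp_comp, (continuous_scal_r (V := R_NormedModule) (INR k) th), Hth.
Qed.

Lemma continuous_linear (c s : R) : continuous (fun r => c * r) s.
Proof. apply (ex_derive_continuous (fun r : R => c * r)). auto_derive; auto. Qed.

Definition clock (lam : R -> R) (v : R -> nat -> R) (G : R -> R) : Prop :=
  (forall s, continuous G s) /\ G 0 = 0 /\
  forall t, 0 <= t -> is_rderive G t (m0 (v t) + lam t).

Lemma first_positive (w : nat -> R) :
  in_N w -> 0 < m0 w ->
  exists k, (1 <= k)%nat /\ 0 < w k /\ forall l, (1 <= l < k)%nat -> w l = 0.
Proof.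
  intros Hw Hm.
  assert (Hex : exists k, (1 <= k)%nat /\ 0 < w k).
  { apply NNPP; intros Hn. destruct (psum_near_m0 w 0 Hw Hm) as [K HK].
    specialize (HK K (le_n K)).
    assert (psum w K <= 0); [|lra]. rewrite <- (psum_zero K). apply psum_le.
    intros k Hk. apply Rnot_lt_le; intros Hk'. apply Hn. exists k; split; [lia|exact Hk']. }
  destruct Hex as [k Hk]. revert Hk. induction k as [k IH] using lt_wf_ind.
  intros [Hk1 Hk].
  destruct (classic (exists l, (1 <= l < k)%nat /\ 0 < w l)) as [[l [Hl Hl']]|Hn].
  - apply (IH l); [lia|split; [lia|exact Hl']].
  - exists k; split; [exact Hk1|split; [exact Hk|]]. intros l Hl.
    apply Rle_antisym; [|apply Hw; lia].
    apply Rnot_lt_le; intros Hl'. apply Hn. exists l; split; assumption.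
Qed.

(** Strong induction on the size: when all smaller sizes are absent the gain term vanishes, and pure
    loss cannot lift a coefficient above 0. *)
Lemma flow_stays_zero (lam : R -> R) (v : R -> nat -> R) (k0 : nat) :
  flow lam v -> (forall t, 0 <= t -> 0 <= lam t) ->
  (forall l, (1 <= l < k0)%nat -> v 0 l = 0) ->
  forall l t, (1 <= l < k0)%nat -> 0 <= t -> v t l = 0.
Proof.
  intros Hf Hl Hz. induction l as [l IH] using lt_wf_ind. intros t Hlk Ht.
  destruct Hf as (HN & Hc & Hm & Hd).
  apply Rle_antisym; [|apply HN; lia].
  apply (stays_nonpos (fun s => v s l) 0 t); [|exact Ht|rewrite Hz by lia; lra|].
  - intros s; apply Hc; lia.
  - intros s Hs Hp. eexists; split; [|apply Hd; [lra|lia]].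
    replace (conv (v s) l) with 0.
    + assert (0 <= INR l * v s l * (m0 (v s) + lam s)); [|lra].
      repeat apply Rmult_le_pos; [apply pos_INR|lra|].
      apply Rplus_le_le_0_compat; [apply m0_nonneg, HN|apply Hl; lra].
    + rewrite conv_psum, <- (psum_zero (l - 1)). symmetry. apply psum_ext.
      intros j Hj. rewrite (IH j) by (lia || lra). ring.
Qed.

(** Tilting by [C * t], where [C] bounds [m0 + lam], absorbs the loss term, so the tilted
    coefficient never decreases. *)
Lemma flow_stays_positive (lam : R -> R) (B : R) (v : R -> nat -> R) (k : nat) (t : R) :
  flow lam v -> (forall t, 0 <= t -> lam t <= B) ->
  (1 <= k)%nat -> 0 < v 0 k -> 0 <= t -> 0 < v t k.
Proof.
  intros Hf HB Hk H0 Ht. set (C := m0 (v 0) + B).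
  assert (H : v 0 k * exp (INR k * (C * 0)) <= v t k * exp (INR k * (C * t))).
  { apply (rderive_nonneg_le (fun s => v s k * exp (INR k * (C * s)))); [|exact Ht|].
    - intros s. apply (continuous_tilt v (fun s => C * s)); [apply Hf, Hk|].
      apply continuous_linear.
    - intros s Hs. eexists; split; [|apply (flow_tilt lam v (fun s => C * s));
        [exact Hf|lra|exact Hk|apply is_rderive_scal, is_rderive_id]].
      destruct Hf as (HN & _ & Hm & _).
      assert (Hu : forall l, (1 <= l)%nat -> 0 <= v s l * exp (INR l * (C * s))).
      { intros l Hl. apply Rmult_le_pos; [apply HN, Hl|left; apply exp_pos]. }
      apply Rplus_le_le_0_compat.
      + apply Rmult_le_pos; [pose proof (pos_INR k); lra|].
        apply (conv_nonneg (fun l => v s l * exp (INR l * (C * s)))), Hu.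
      + apply Rmult_le_pos; [|apply Hu, Hk].
        apply Rmult_le_pos; [apply pos_INR|].
        specialize (Hm 0 s ltac:(lra)). specialize (HB s ltac:(lra)). unfold C; lra. }
  pose proof (exp_pos (INR k * (C * t))) as Hp.
  rewrite Rmult_0_r, Rmult_0_r, exp_0, Rmult_1_r in H.
  apply Rnot_le_lt; intros Hn. nra.
Qed.

(* While all smaller sizes are absent, the smallest size k decays exactly like
   exp (- k G); this gives the clock without integrating the mass. *)
Lemma clock_exists (lam : R -> R) (B : R) (v : R -> nat -> R) :
  flow lam v -> (forall t, 0 <= t -> 0 <= lam t <= B) -> 0 < m0 (v 0) ->
  exists G, clock lam v G.
Proof.
  intros Hf HB Hm. pose proof Hf as (HN & Hc & _ & Hd).
  destruct (first_positive (v 0) (HN 0) Hm) as (k & Hk & Hpos & Hz).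
  assert (Hp : forall t, 0 <= t -> 0 < v t k).
  { intros t Ht. apply (flow_stays_positive lam B); try assumption.
    intros s Hs; apply HB, Hs. }
  assert (HIk : 0 < INR k) by (apply lt_0_INR; lia).
  (* The relation [v s k = v 0 k * exp (- k G)] solved for [G]. The [Rmax 0] keeps the argument of
     [ln] positive at negative times, where [flow] ensures no positivity. *)
  exists (fun s => / INR k * (ln (v 0 k) - ln (v (Rmax 0 s) k))).
  split; [|split].
  - intros s. apply (continuous_scal_r (V := R_NormedModule) (/ INR k)
                       (fun s => ln (v 0 k) - ln (v (Rmax 0 s) k))).
    apply (continuous_minus (V := R_NormedModule) (fun _ => ln (v 0 k)));
      [apply continuous_const|].
    apply (continuous_comp (fun s => v (Rmax 0 s) k) ln).
    + apply (continuous_comp (fun s => Rmax 0 s) (fun s => v s k));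
        [apply continuous_Rmax_r|apply Hc, Hk].
    + apply (ex_derive_continuous ln). eexists. apply is_derive_ln, Hp, Rmax_l.
  - rewrite Rmax_left by lra. ring.
  - intros t Ht.
    apply is_rderive_ext with (fun s => / INR k * (ln (v 0 k) - ln (v s k))).
    { intros s Hs. rewrite Rmax_right by lra. reflexivity. }
    eapply is_rderive_val.
    + apply is_rderive_scal, is_rderive_minus; [apply is_rderive_const|].
      apply (is_rderive_comp ln (fun s => v s k)).
      * apply is_derive_ln, Hp, Ht.
      * apply Hd; assumption.
    + replace (conv (v t) k) with 0.
      * specialize (Hp t Ht). field. lra.
      * rewrite conv_psum, <- (psum_zero (k - 1)). symmetry. apply psum_ext.
        intros j Hj. rewrite (flow_stays_zero lam v k Hf) with (l := j);
          [ring|intros s Hs; apply HB, Hs|exact Hz|lia|exact Ht].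
Qed.

(* [v_k e^{kG}] solves [w_k' = k/2 * conv w k], in which neither the rate nor the
   mass appears. *)
Lemma tilted_unique (lam1 lam2 : R -> R) (v1 v2 : R -> nat -> R) (G1 G2 : R -> R) :
  flow lam1 v1 -> flow lam2 v2 -> clock lam1 v1 G1 -> clock lam2 v2 G2 ->
  (forall k, (1 <= k)%nat -> v1 0 k = v2 0 k) ->
  forall k t, (1 <= k)%nat -> 0 <= t ->
    v1 t k * exp (INR k * G1 t) = v2 t k * exp (INR k * G2 t).
Proof.
  intros F1 F2 (C1 & Z1 & D1) (C2 & Z2 & D2) H0.
  induction k as [k IH] using lt_wf_ind. intros t Hk Ht.
  assert (K1 : forall s, continuous (fun s => v1 s k * exp (INR k * G1 s)) s).
  { intros s. apply continuous_tilt; [apply F1, Hk|apply C1]. }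
  assert (K2 : forall s, continuous (fun s => v2 s k * exp (INR k * G2 s)) s).
  { intros s. apply continuous_tilt; [apply F2, Hk|apply C2]. }
  assert (E1 : forall s, 0 <= s ->
    is_rderive (fun s => v1 s k * exp (INR k * G1 s)) s
      (INR k / 2 * conv (fun l => v1 s l * exp (INR l * G1 s)) k)).
  { intros s Hs. eapply is_rderive_val;
      [apply (flow_tilt lam1 v1 G1); [assumption..|apply D1, Hs]|ring]. }
  assert (E2 : forall s, 0 <= s ->
    is_rderive (fun s => v2 s k * exp (INR k * G2 s)) s
      (INR k / 2 * conv (fun l => v1 s l * exp (INR l * G1 s)) k)).
  { intros s Hs. eapply is_rderive_val;
      [apply (flow_tilt lam2 v2 G2); [assumption..|apply D2, Hs]|].
    rewrite (conv_ext (fun l => v1 s l * exp (INR l * G1 s))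
                      (fun l => v2 s l * exp (INR l * G2 s))); [ring|].
    intros l Hl. apply IH; [lia|lia|exact Hs]. }
  assert (I : v1 0 k * exp (INR k * G1 0) = v2 0 k * exp (INR k * G2 0)).
  { rewrite Z1, Z2, H0 by exact Hk. reflexivity. }
  apply Rle_antisym.
  - enough (v2 0 k * exp (INR k * G2 0) - v1 0 k * exp (INR k * G1 0) <=
            v2 t k * exp (INR k * G2 t) - v1 t k * exp (INR k * G1 t)) by lra.
    apply (rderive_nonneg_le
      (fun s => v2 s k * exp (INR k * G2 s) - v1 s k * exp (INR k * G1 s)) 0 t);
      [|exact Ht|].
    + intros s. apply (continuous_minus (V := R_NormedModule)
        (fun s => v2 s k * exp (INR k * G2 s))); [apply K2|apply K1].
    + intros s Hs. eexists; split; [|apply is_rderive_minus; [apply E2|apply E1]; lra].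
      lra.
  - enough (v1 0 k * exp (INR k * G1 0) - v2 0 k * exp (INR k * G2 0) <=
            v1 t k * exp (INR k * G1 t) - v2 t k * exp (INR k * G2 t)) by lra.
    apply (rderive_nonneg_le
      (fun s => v1 s k * exp (INR k * G1 s) - v2 s k * exp (INR k * G2 s)) 0 t);
      [|exact Ht|].
    + intros s. apply (continuous_minus (V := R_NormedModule)
        (fun s => v1 s k * exp (INR k * G1 s))); [apply K1|apply K2].
    + intros s Hs. eexists; split; [|apply is_rderive_minus; [apply E1|apply E2]; lra].
      lra.
Qed.

Lemma tilted_transport (lam1 lam2 : R -> R) (v1 v2 : R -> nat -> R) (G1 G2 : R -> R) :
  flow lam1 v1 -> flow lam2 v2 -> clock lam1 v1 G1 -> clock lam2 v2 G2 ->
  (forall k, (1 <= k)%nat -> v1 0 k = v2 0 k) ->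
  forall k t, (1 <= k)%nat -> 0 <= t ->
    v1 t k = v2 t k * exp (INR k * (G2 t - G1 t)).
Proof.
  intros F1 F2 C1 C2 H0 k t Hk Ht.
  pose proof (tilted_unique lam1 lam2 v1 v2 G1 G2 F1 F2 C1 C2 H0 k t Hk Ht) as E.
  replace (INR k * (G2 t - G1 t)) with (INR k * G2 t + - (INR k * G1 t)) by ring.
  rewrite exp_plus, exp_Ropp, <- Rmult_assoc, <- E. field.
  apply Rgt_not_eq, exp_pos.
Qed.

(** At a later clock each coefficient carries the factor [exp (INR k * (G2 t - G1 t)) <= 1]; partial
    sums pass this on to the mass. *)
Lemma mass_compare (lam1 lam2 : R -> R) (v1 v2 : R -> nat -> R) (G1 G2 : R -> R) (t : R) :
  flow lam1 v1 -> flow lam2 v2 -> clock lam1 v1 G1 -> clock lam2 v2 G2 ->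
  (forall k, (1 <= k)%nat -> v1 0 k = v2 0 k) ->
  0 <= t -> G2 t <= G1 t -> m0 (v1 t) <= m0 (v2 t).
Proof.
  intros F1 F2 C1 C2 H0 Ht HG. apply Rnot_lt_le; intros Hlt.
  destruct (psum_near_m0 (v1 t) (m0 (v2 t))) as [K HK]; [apply F1|exact Hlt|].
  specialize (HK K (le_n K)).
  assert (psum (v1 t) K <= psum (v2 t) K).
  { apply psum_le. intros k Hk.
    rewrite (tilted_transport lam1 lam2 v1 v2 G1 G2) by (assumption || lia).
    rewrite <- (Rmult_1_r (v2 t k)) at 2. apply Rmult_le_compat_l; [apply F2; lia|].
    rewrite <- exp_0. apply exp_monotone. pose proof (pos_INR k). nra. }
  pose proof (psum_le_m0 (v2 t) K ltac:(apply F2)). lra.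
Qed.

(* The clock solves [G' = lam + m0], and the mass is a decreasing function of [G]
   alone at a given time, so perturbations of [lam] are not amplified. *)
Lemma clock_compare (lam1 lam2 : R -> R) (v1 v2 : R -> nat -> R) (G1 G2 : R -> R) (e t : R) :
  flow lam1 v1 -> flow lam2 v2 -> clock lam1 v1 G1 -> clock lam2 v2 G2 ->
  (forall k, (1 <= k)%nat -> v1 0 k = v2 0 k) ->
  (forall s, 0 <= s -> lam1 s <= lam2 s + e) ->
  0 <= t -> 0 <= e -> G1 t <= G2 t + e * t.
Proof.
  intros F1 F2 C1 C2 H0 Hl Ht He.
  enough ((G1 t - G2 t) + (0 + (- e) * t) <= 0) by lra.
  apply (stays_nonpos (fun s => (G1 s - G2 s) + (0 + (- e) * s)) 0 t); [|exact Ht| |].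
  - intros s. apply (continuous_Rlin (fun s => G1 s - G2 s)).
    apply (continuous_minus (V := R_NormedModule) G1); [apply C1|apply C2].
  - destruct C1 as (_ & -> & _), C2 as (_ & -> & _). lra.
  - intros s Hs Hp. eexists; split.
    2: { apply (is_rderive_lin (fun s => G1 s - G2 s)), is_rderive_minus;
         [apply C1|apply C2]; lra. }
    (* Where the difference is positive, [G1 s >= G2 s], so the masses are ordered the opposite way
       and the drift [- e] covers the gap between the rates. *)
    assert (m0 (v1 s) <= m0 (v2 s)).
    { apply (mass_compare lam1 lam2 v1 v2 G1 G2); try assumption; [lra|].
      assert (0 <= e * s) by (apply Rmult_le_pos; lra). lra. }
    specialize (Hl s ltac:(lra)). lra.
Qed.

(** * Characteristics *)

(* The generating function [sum_k w_k z^k] (truncated) at [z = exp th]. *)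
Definition gen (w : nat -> R) (K : nat) (th : R) : R :=
  psum (fun k => w k * exp (INR k * th)) K.

Lemma gen_zero (w : nat -> R) (K : nat) : gen w K 0 = psum w K.
Proof. apply psum_ext. intros k _. rewrite Rmult_0_r, exp_0. ring. Qed.

Lemma gen_le (w : nat -> R) (K : nat) (a b : R) :
  in_N w -> a <= b -> gen w K a <= gen w K b.
Proof.
  intros Hw Hab. apply psum_le. intros k Hk.
  apply Rmult_le_compat_l; [apply Hw; lia|].
  apply exp_monotone, Rmult_le_compat_l; [apply pos_INR|exact Hab].
Qed.

Lemma continuous_gen (w : nat -> R) (K : nat) (f : R -> R) (s : R) :
  continuous f s -> continuous (fun r => gen w K (f r)) s.
Proof.
  intros Hf. apply (continuous_psum (fun r k => w k * exp (INR k * f r))).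
  intros k _. apply (continuous_tilt (fun _ => w)); [apply continuous_const|exact Hf].
Qed.

Lemma psum_tail (a : nat -> R) (c : R) (m n : nat) :
  (m <= n)%nat -> (forall k, (m < k <= n)%nat -> a k <= c) ->
  psum a n <= psum a m + INR (n - m) * c.
Proof.
  intros Hmn. induction Hmn as [|n Hmn IH]; intros H.
  - rewrite Nat.sub_diag. simpl. lra.
  - rewrite Nat.sub_succ_l, S_INR by exact Hmn. simpl psum.
    assert (psum a n <= psum a m + INR (n - m) * c) by (apply IH; intros; apply H; lia).
    specialize (H (S n) ltac:(lia)). lra.
Qed.

Lemma term_le_psum (a : nat -> R) (k n : nat) :
  (forall j, (1 <= j <= n)%nat -> 0 <= a j) -> (1 <= k <= n)%nat -> a k <= psum a n.
Proof.
  intros H Hk. apply Rle_trans with (psum a k); [|apply psum_mono; [exact H|lia]].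
  destruct k as [|k]; [lia|]. simpl.
  assert (0 <= psum a k) by (apply psum_nonneg; intros; apply H; lia). lra.
Qed.

Lemma gen_stable (w : nat -> R) (K0 K : nat) (th : R) :
  (forall k, (K0 < k)%nat -> w k = 0) -> (K0 <= K)%nat -> gen w K th = gen w K0 th.
Proof.
  intros H HK. induction HK as [|K HK IH]; [reflexivity|].
  unfold gen in *. simpl psum. rewrite IH, H by lia. ring.
Qed.

(* Along the characteristic [th] with [th' = m0 + lam - w] the equations keep their
   form, with the mass replaced by the constant [w]. *)
Lemma characteristic_rderive (lam : R -> R) (v : R -> nat -> R) (G : R -> R)
    (w c : R) (K : nat) (s : R) :
  flow lam v -> clock lam v G -> 0 <= s ->
  is_rderive (fun r => gen (v r) K (G r - w * r + c)) s
    (psum (fun l => INR l * (v s l * exp (INR l * (G s - w * s + c))) *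
                    (gen (v s) (K - l) (G s - w * s + c) - w)) K).
Proof.
  intros HF HC Hs. set (th := fun r => G r - w * r + c).
  set (u := fun l => v s l * exp (INR l * th s)).
  apply is_rderive_val with (psum (fun k => INR k / 2 * conv u k + - w * (INR k * u k)) K).
  - apply (is_rderive_psum (fun r k => v r k * exp (INR k * th r))).
    intros k Hk. eapply is_rderive_val.
    + apply (flow_tilt lam v th); [exact HF|exact Hs|lia|].
      apply is_rderive_plus; [|apply is_rderive_const].
      apply is_rderive_minus; [apply HC, Hs|apply is_rderive_scal, is_rderive_id].
    + unfold u. cbv beta. ring.
  - rewrite psum_plus, psum_conv, <- psum_plus. apply psum_ext. intros l Hl.
    unfold gen, u, th. ring.
Qed.

Lemma continuous_characteristic (lam : R -> R) (v : R -> nat -> R) (G : R -> R)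
    (w c : R) (K : nat) (s : R) :
  flow lam v -> clock lam v G ->
  continuous (fun r => gen (v r) K (G r - w * r + c)) s.
Proof.
  intros HF HC.
  apply (continuous_psum (fun r k => v r k * exp (INR k * (G r - w * r + c)))).
  intros k Hk. apply (continuous_tilt v (fun r => G r - w * r + c)); [apply HF; lia|].
  apply (continuous_ext (fun r => G r + (c + (- w) * r))); [intros; simpl; ring|].
  apply continuous_Rlin, HC.
Qed.

(** If the truncated sum were below [w] at time 0, every factor [gen - w] in its derivative would be
    negative as long as this lasts, shorter sums being smaller; the sum would then stay below [w]
    until time [t]. Truncation helps in this direction. *)
Lemma char_lower (lam : R -> R) (v : R -> nat -> R) (G : R -> R) (w t : R) (K : nat) :
  flow lam v -> clock lam v G -> 0 <= t -> w <= psum (v t) K ->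
  w <= gen (v 0) K (t * w - G t).
Proof.
  intros HF HC Ht Hw. apply Rnot_lt_le; intros Hlt.
  (* The characteristic then reaches 0 at time [t], where [gen] is a partial sum of the mass. *)
  set (c := t * w - G t).
  set (h := fun r => gen (v r) K (G r - w * r + c)).
  assert (H0 : h 0 = gen (v 0) K (t * w - G t)).
  { unfold h, c. f_equal. destruct HC as (_ & -> & _). ring. }
  assert (H1 : h t = psum (v t) K).
  { unfold h, c. rewrite <- gen_zero. f_equal. ring. }
  assert (H : w - h 0 <= w - h t); [|lra].
  apply (positive_growth (fun s => w - h s)); [|exact Ht|lra|].
  - intros s. apply (continuous_minus (V := R_NormedModule) (fun _ => w));
      [apply continuous_const|apply (continuous_characteristic lam); assumption].
  - intros s Hs Hp. eexists; split.
    2: { apply is_rderive_minus; [apply is_rderive_const|].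
         apply (characteristic_rderive lam); [assumption..|lra]. }
    rewrite Rminus_0_l. apply Ropp_0_ge_le_contravar, Rle_ge.
    rewrite <- (psum_zero K). apply psum_le. intros l Hl.
    assert (Hu : forall j, (1 <= j)%nat -> 0 <= v s j * exp (INR j * (G s - w * s + c))).
    { intros j Hj. apply Rmult_le_pos; [apply HF, Hj|left; apply exp_pos]. }
    assert (Hm : gen (v s) (K - l) (G s - w * s + c) <= h s).
    { apply psum_mono; [intros; apply Hu; lia|lia]. }
    assert (0 <= INR l * (v s l * exp (INR l * (G s - w * s + c)))).
    { apply Rmult_le_pos; [apply pos_INR|apply Hu; lia]. }
    nra.
Qed.

(** The mass is antitone, so up to time [t] the clock runs at speed at least [m0 (v t)]. *)
Lemma clock_rate_ge (lam : R -> R) (v : R -> nat -> R) (G : R -> R) (s t : R) :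
  flow lam v -> clock lam v G -> (forall r, 0 <= r -> 0 <= lam r) ->
  0 <= s <= t -> (t - s) * m0 (v t) <= G t - G s.
Proof.
  intros HF (Gc & _ & Gd) Hl Hst.
  enough (G s + (0 + (- m0 (v t)) * s) <= G t + (0 + (- m0 (v t)) * t)) by lra.
  apply (rderive_nonneg_le (fun r => G r + (0 + (- m0 (v t)) * r))); [|lra|].
  - intros r. apply continuous_Rlin, Gc.
  - intros r Hr. eexists; split; [|apply is_rderive_lin, Gd; lra].
    destruct HF as (_ & _ & Hm & _). specialize (Hm r t ltac:(lra)).
    specialize (Hl r ltac:(lra)). lra.
Qed.

(* Mass may leak out of the truncated sum, but for [x > 0] the weights decay
   exponentially along the characteristic, so the leak is negligible. *)
Lemma char_upper_approx (lam : R -> R) (v : R -> nat -> R) (G : R -> R) (x t : R) (K : nat) :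
  flow lam v -> clock lam v G -> (forall r, 0 <= r -> 0 <= lam r) ->
  0 <= t -> 0 < x ->
  gen (v 0) K (t * m0 (v t) - G t - x) <=
  m0 (v t) + INR K * (INR K * INR K * (m0 (v 0) * m0 (v 0) * exp (- (INR K * x)))) * t.
Proof.
  intros HF HC Hl Ht Hx. set (w := m0 (v t)). set (C := m0 (v 0)).
  (* [e1] bounds the leak in each of the [K] summands of the derivative. *)
  set (e1 := INR K * INR K * (C * C * exp (- (INR K * x)))).
  (* The characteristic ends at [- x]; by [clock_rate_ge] it is at most [- x] at all earlier times
     too. *)
  set (c := t * w - G t - x).
  set (h := fun r => gen (v r) K (G r - w * r + c)).
  assert (H0 : h 0 = gen (v 0) K c).
  { unfold h. f_equal. destruct HC as (_ & -> & _). ring. }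
  assert (HC0 : 0 <= C) by apply m0_nonneg, HF.
  assert (H1 : h t <= w).
  { apply Rle_trans with (gen (v t) K 0).
    - apply gen_le; [apply HF|]. unfold c. lra.
    - rewrite gen_zero. apply psum_le_m0, HF. }
  apply Rnot_lt_le; intros Hlt. rewrite <- H0 in Hlt.
  assert (He : 0 <= INR K * e1).
  { pose proof (pos_INR K). pose proof (exp_pos (- (INR K * x))).
    unfold e1. repeat apply Rmult_le_pos; lra. }
  (* The slope [INR K * e1] compensates the total leak, so [f] cannot decrease while it is
     positive. *)
  set (f := fun s => h s + ((- w - INR K * e1 * t) + INR K * e1 * s)).
  assert (H : f 0 <= f t); [|unfold f in H; lra].
  apply positive_growth; [|exact Ht|unfold f; lra|].
  - intros s. apply continuous_Rlin, (continuous_characteristic lam); assumption.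
  - intros s Hs Hp. unfold f in Hp.
    assert (Hhw : w < h s).
    { assert (INR K * e1 * s <= INR K * e1 * t) by (apply Rmult_le_compat_l; lra). lra. }
    eexists; split.
    2: { apply is_rderive_lin, (characteristic_rderive lam); [assumption..|lra]. }
    rewrite <- psum_const, <- psum_plus. apply psum_nonneg. intros l Hlk.
    set (th := G s - w * s + c).
    assert (Hth : th <= - x).
    { pose proof (clock_rate_ge lam v G s t HF HC Hl ltac:(lra)) as Hr.
      fold w in Hr. unfold th, c. lra. }
    set (u := fun j => v s j * exp (INR j * th)).
    assert (Hu0 : forall j, (1 <= j)%nat -> 0 <= u j).
    { intros j Hj. apply Rmult_le_pos; [apply HF, Hj|left; apply exp_pos]. }
    assert (Hu1 : forall i j, (1 <= j)%nat -> (i <= j)%nat -> u j <= C * exp (- (INR i * x))).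
    { intros i j Hj Hij. apply Rmult_le_compat.
      - apply HF, Hj.
      - left; apply exp_pos.
      - apply Rle_trans with (m0 (v s)); [apply le_m0; [apply HF|exact Hj]|].
        apply HF; lra.
      - apply exp_monotone. apply le_INR in Hij. pose proof (pos_INR i). nra. }
    assert (Ht1 : h s <= gen (v s) (K - l) th + INR l * (C * exp (- (INR (K - l) * x)))).
    { unfold h. fold th. replace l with (K - (K - l))%nat at 2 by lia.
      apply (psum_tail u); [lia|]. intros k Hk. apply Hu1; lia. }
    fold (u l). pose proof (Hu0 l ltac:(lia)) as Hul0.
    pose proof (Hu1 l l ltac:(lia) (le_n l)) as Hul1.
    pose proof (pos_INR l) as Hl0.
    assert (HlK : INR l <= INR K) by (apply le_INR; lia).
    set (D := C * exp (- (INR (K - l) * x))) in *.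
    assert (HD : 0 <= D) by (apply Rmult_le_pos; [exact HC0|left; apply exp_pos]).
    (* [u l] decays with [l] and the leak with [K - l]: together they give [exp (- (INR K * x))]
       whatever [l] is. *)
    assert (Hprod : INR l * u l * (INR l * D) <= e1).
    { replace (INR l * u l * (INR l * D)) with (INR l * INR l * (u l * D)) by ring.
      unfold e1. apply Rmult_le_compat.
      - apply Rmult_le_pos; lra.
      - apply Rmult_le_pos; lra.
      - apply Rmult_le_compat; lra.
      - apply Rle_trans with (C * exp (- (INR l * x)) * D); [apply Rmult_le_compat_r; lra|].
        right. unfold D.
        replace (- (INR K * x)) with (- (INR l * x) + - (INR (K - l) * x))
          by (rewrite minus_INR by lia; ring).
        rewrite exp_plus. ring. }
    assert (INR l * u l * (- (INR l * D)) <= INR l * u l * (gen (v s) (K - l) th - w)).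
    { apply Rmult_le_compat_l; [apply Rmult_le_pos; lra|lra]. }
    lra.
Qed.

(** Four factors [exp (- y) <= / y] with [y = K x / 4] beat the cubic prefactor and leave one power
    of [1 / K]. *)
Lemma cube_exp_bound (x : R) (K : nat) :
  0 < x -> (1 <= K)%nat ->
  INR K * (INR K * INR K * exp (- (INR K * x))) <= (4 / x) ^ 4 / INR K.
Proof.
  intros Hx HK. assert (HK' : 0 < INR K) by (apply lt_0_INR; lia).
  set (y := INR K * x / 4).
  assert (Hy : 0 < y) by (unfold y; apply Rdiv_lt_0_compat; [nra|lra]).
  assert (He : exp (- y) <= / y).
  { rewrite exp_Ropp. apply Rinv_le_contravar; [exact Hy|].
    pose proof (exp_ineq1_le y). lra. }
  replace (- (INR K * x)) with (((- y + - y) + - y) + - y) by (unfold y; field).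
  rewrite !exp_plus.
  replace (exp (- y) * exp (- y) * exp (- y) * exp (- y)) with (exp (- y) ^ 4) by ring.
  replace ((4 / x) ^ 4 / INR K) with (INR K * (INR K * INR K * (/ y) ^ 4)).
  - repeat (apply Rmult_le_compat_l; [nra|]).
    apply pow_incr. split; [left; apply exp_pos|exact He].
  - unfold y. field. lra.
Qed.

Lemma left_limit_le (f : R -> R) (a t c : R) :
  continuous f t -> a < t -> (forall s, a <= s < t -> f s <= c) -> f t <= c.
Proof.
  intros Hc Hat H. apply Rnot_lt_le; intros Hlt.
  destruct (proj1 (continuous_Reps f t) Hc (f t - c)) as [d [Hd Hd']]; [lra|].
  set (s := Rmax a (t - d / 2)).
  assert (a <= s) by apply Rmax_l. assert (t - d / 2 <= s) by apply Rmax_r.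
  assert (s < t) by (unfold s; apply Rmax_lub_lt; lra).
  specialize (H s ltac:(lra)). specialize (Hd' s ltac:(apply Rabs_def1; lra)).
  apply Rabs_def2 in Hd'. lra.
Qed.

(** First [K] grows at fixed [x]: by finite support the left side no longer changes while the error
    vanishes. Then [x] tends to 0 by continuity. *)
Lemma char_upper (lam : R -> R) (v : R -> nat -> R) (G : R -> R) (t : R) (K0 : nat) :
  flow lam v -> clock lam v G -> (forall r, 0 <= r -> 0 <= lam r) ->
  (forall k, (K0 < k)%nat -> v 0 k = 0) -> 0 <= t ->
  gen (v 0) K0 (t * m0 (v t) - G t) <= m0 (v t).
Proof.
  intros HF HC Hl Hz Ht.
  assert (Hx : forall x, 0 < x -> gen (v 0) K0 (t * m0 (v t) - G t - x) <= m0 (v t)).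
  { intros x Hx. set (C := m0 (v 0)). set (A := C * C * (4 / x) ^ 4 * t).
    assert (HCt : 0 <= C * C * t).
    { assert (0 <= C) by apply m0_nonneg, HF. repeat apply Rmult_le_pos; assumption. }
    apply Rnot_lt_le; intros Hlt.
    set (d := gen (v 0) K0 (t * m0 (v t) - G t - x) - m0 (v t)).
    destruct (INR_unbounded (A / d)) as [N HN].
    assert (Hd : 0 < d) by (unfold d; lra).
    (* [K] passes the support bound, is at least 1 and exceeds [A / d], which makes the error less
       than [d]. *)
    set (K := (S K0 + N)%nat).
    pose proof (char_upper_approx lam v G x t K HF HC Hl Ht Hx) as Ha.
    rewrite (gen_stable _ K0 K) in Ha by (exact Hz || (unfold K; lia)).
    fold C in Ha.
    assert (HK : 0 < INR K) by (apply lt_0_INR; unfold K; lia).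
    assert (HNK : INR N <= INR K) by (apply le_INR; unfold K; lia).
    assert (Hb : INR K * (INR K * INR K * (C * C * exp (- (INR K * x)))) * t <= A / INR K).
    { replace (INR K * (INR K * INR K * (C * C * exp (- (INR K * x)))) * t) with
        (C * C * t * (INR K * (INR K * INR K * exp (- (INR K * x))))) by ring.
      replace (A / INR K) with (C * C * t * ((4 / x) ^ 4 / INR K))
        by (unfold A; field; lra).
      apply Rmult_le_compat_l.
      - exact HCt.
      - apply cube_exp_bound; [exact Hx|unfold K; lia]. }
    assert (Hc : A / INR K < d).
    { apply Rmult_lt_reg_r with (INR K); [exact HK|].
      replace (A / INR K * INR K) with A by (field; lra).
      assert (A < INR N * d).
      { apply Rmult_lt_reg_r with (/ d); [apply Rinv_0_lt_compat, Hd|].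
        replace (INR N * d * / d) with (INR N) by (field; lra). exact HN. }
      nra. }
    unfold d in Hc. lra. }
  assert (H : gen (v 0) K0 (t * m0 (v t) - G t + 0) <= m0 (v t)).
  { apply (left_limit_le (fun y => gen (v 0) K0 (t * m0 (v t) - G t + y)) (-1)); [|lra|].
    - apply continuous_gen.
      apply (continuous_plus (V := R_NormedModule) (fun _ => t * m0 (v t) - G t));
        [apply continuous_const|apply continuous_id].
    - intros s Hs. replace (t * m0 (v t) - G t + s) with (t * m0 (v t) - G t - (- s)) by ring.
      apply Hx. lra. }
  rewrite Rplus_0_r in H. exact H.
Qed.

(** A [w] strictly below the mass lies below some partial sum; truncating beyond [K0] does not alter
    the initial generating polynomial. *)
Lemma char_lower_mass (lam : R -> R) (v : R -> nat -> R) (G : R -> R) (w t : R) (K0 : nat) :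
  flow lam v -> clock lam v G -> (forall k, (K0 < k)%nat -> v 0 k = 0) ->
  0 <= t -> w < m0 (v t) -> w <= gen (v 0) K0 (t * w - G t).
Proof.
  intros HF HC Hz Ht Hw.
  destruct (psum_near_m0 (v t) w) as [K1 HK1]; [apply HF|exact Hw|].
  rewrite <- (gen_stable (v 0) K0 (K0 + K1)) by (exact Hz || lia).
  apply (char_lower lam); try assumption. left. apply HK1; lia.
Qed.

(** * Continuity and decay of the mass *)

Lemma gen_strictly_convex (w : nat -> R) (K k : nat) (a b : R) :
  in_N w -> (1 <= k <= K)%nat -> 0 < w k -> a < b ->
  2 * gen w K ((a + b) / 2) < gen w K a + gen w K b.
Proof.
  intros Hw Hk Hp Hab.
  (* With [X], [Y] the exponentials at half arguments, [X^2 + Y^2 = (X - Y)^2 + 2 X Y], and [X Y] is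
     the exponential at the midpoint; [q] collects the squares. *)
  set (q := fun j => w j * (exp (INR j * (a / 2)) - exp (INR j * (b / 2))) ^ 2).
  assert (E : gen w K a + gen w K b = psum q K + 2 * gen w K ((a + b) / 2)).
  { unfold gen. rewrite <- psum_plus, <- psum_scal, <- psum_plus. apply psum_ext.
    intros j _. unfold q.
    replace (INR j * a) with (INR j * (a / 2) + INR j * (a / 2)) by field.
    replace (INR j * b) with (INR j * (b / 2) + INR j * (b / 2)) by field.
    replace (INR j * ((a + b) / 2)) with (INR j * (a / 2) + INR j * (b / 2)) by field.
    rewrite !exp_plus. ring. }
  assert (Hq : q k <= psum q K).
  { apply term_le_psum; [|exact Hk]. intros j Hj.
    apply Rmult_le_pos; [apply Hw; lia|apply pow2_ge_0]. }
  assert (0 < q k); [|lra].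
  apply Rmult_lt_0_compat; [exact Hp|].
  assert (exp (INR k * (a / 2)) < exp (INR k * (b / 2))).
  { apply exp_increasing, Rmult_lt_compat_l; [apply lt_0_INR; lia|lra]. }
  nra.
Qed.

(* If the mass jumped from [M] down to [m] at [t], then [gen (t w - G t) - w] would
   vanish at [m] and [M] without being negative in between. *)
Lemma mass_left_continuous (lam : R -> R) (v : R -> nat -> R) (G : R -> R) (K0 : nat) (t eps : R) :
  flow lam v -> clock lam v G -> (forall r, 0 <= r -> 0 <= lam r) ->
  (forall k, (K0 < k)%nat -> v 0 k = 0) -> 0 < m0 (v 0) -> 0 < t -> 0 < eps ->
  exists s, 0 <= s < t /\ m0 (v s) < m0 (v t) + eps.
Proof.
  intros HF HC Hl Hz Hm Ht He. apply NNPP; intros Hn.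
  assert (Hjump : forall s, 0 <= s < t -> m0 (v t) + eps <= m0 (v s)).
  { intros s Hs. apply Rnot_lt_le; intros Hlt. apply Hn. exists s; split; assumption. }
  (* The left limit [M] of the mass at [t] is an infimum, obtained as minus a supremum. *)
  destruct (completeness (fun y => exists s, 0 <= s < t /\ y = - m0 (v s))) as [M' [Hub Hlub]].
  { exists 0. intros y [s [Hs ->]]. pose proof (m0_nonneg (v s) ltac:(apply HF)). lra. }
  { exists (- m0 (v 0)), 0. split; [lra|reflexivity]. }
  set (M := - M'). set (m := m0 (v t)) in *.
  assert (HM : forall s, 0 <= s < t -> M <= m0 (v s)).
  { intros s Hs. enough (- m0 (v s) <= M') by (unfold M; lra).
    apply Hub. exists s; split; [exact Hs|reflexivity]. }
  assert (HmM : m + eps <= M).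
  { enough (M' <= - (m + eps)) by (unfold M; lra).
    apply Hlub. intros y [s [Hs ->]]. specialize (Hjump s Hs). lra. }
  assert (Happ : forall d, 0 < d -> exists s, 0 <= s < t /\ m0 (v s) < M + d).
  { intros d Hd. apply NNPP; intros Hno.
    assert (M' <= M' - d); [|lra]. apply Hlub. intros y [s [Hs ->]].
    enough (M + d <= m0 (v s)) by (unfold M in *; lra).
    apply Rnot_lt_le; intros Hlt. apply Hno. exists s; split; assumption. }
  assert (Hcont : forall c, continuous (fun s => gen (v 0) K0 (s * c - G s)) t).
  { intros c. apply continuous_gen.
    apply (continuous_minus (V := R_NormedModule) (fun s => s * c)); [|apply HC].
    apply (continuous_ext (fun s => c * s)); [intros; simpl; ring|apply continuous_linear]. }
  (* [char_upper] at times before [t] with mass close to [M], carried to [t] by continuity of the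
     clock. *)
  assert (HgM : gen (v 0) K0 (t * M - G t) <= M).
  { apply le_epsilon. intros d Hd. destruct (Happ d Hd) as [s1 [Hs1 Hs1']].
    apply (left_limit_le (fun s => gen (v 0) K0 (s * M - G s)) s1); [apply Hcont|lra|].
    intros s Hs. apply Rle_trans with (gen (v 0) K0 (s * m0 (v s) - G s)).
    - apply gen_le; [apply HF|]. specialize (HM s ltac:(lra)).
      assert (s * M <= s * m0 (v s)) by (apply Rmult_le_compat_l; lra). lra.
    - apply Rle_trans with (m0 (v s)); [apply (char_upper lam); try assumption; lra|].
      destruct HF as (_ & _ & Hmon & _). specialize (Hmon s1 s ltac:(lra)). lra. }
  assert (Hgm : gen (v 0) K0 (t * m - G t) <= m).
  { apply (char_upper lam); try assumption; lra. }
  set (p := (m + M) / 2).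
  (* The midpoint [p] lies below every earlier mass, so [char_lower_mass] applies before [t] and
     passes to the limit. *)
  assert (Hgp : p <= gen (v 0) K0 (t * p - G t)).
  { enough (- gen (v 0) K0 (t * p - G t) <= - p) by lra.
    apply (left_limit_le (fun s => - gen (v 0) K0 (s * p - G s)) 0); [|lra|].
    - apply (continuous_opp (V := R_NormedModule)), Hcont.
    - intros s Hs. apply Ropp_le_contravar, (char_lower_mass lam); try assumption; [lra|].
      specialize (HM s Hs). unfold p; lra. }
  destruct (first_positive (v 0)) as (k & Hk & Hkp & _); [apply HF|exact Hm|].
  assert (Hk0 : (1 <= k <= K0)%nat).
  { split; [exact Hk|]. destruct (Nat.le_gt_cases k K0) as [?|Hgt]; [assumption|].
    rewrite (Hz k Hgt) in Hkp. lra. }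
  pose proof (gen_strictly_convex (v 0) K0 k (t * m - G t) (t * M - G t)
                ltac:(apply HF) Hk0 Hkp ltac:(nra)) as Hs.
  replace ((t * m - G t + (t * M - G t)) / 2) with (t * p - G t) in Hs
    by (unfold p; field).
  (* Strict convexity puts twice the midpoint value below [m + M = 2 p], against [Hgp]. *)
  unfold p in *. lra.
Qed.

(** With [c = m0 (v t)], [C = m0 (v 0)] and [y = t c / 2], the bound [G t >= t c] puts the
    characteristic at or below [- y], so [c / 2 <= exp (- y) C <= C / (1 + y)]; dropping the 1 gives
    the claim. *)
Lemma mass_decay (lam : R -> R) (v : R -> nat -> R) (G : R -> R) (K0 : nat) (t : R) :
  flow lam v -> clock lam v G -> (forall r, 0 <= r -> 0 <= lam r) ->
  (forall k, (K0 < k)%nat -> v 0 k = 0) -> 0 <= t ->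
  m0 (v t) * m0 (v t) * t <= 4 * m0 (v 0).
Proof.
  intros HF HC Hl Hz Ht. set (c := m0 (v t)). set (C := m0 (v 0)).
  assert (HC0 : 0 <= C) by apply m0_nonneg, HF.
  assert (Hc0 : 0 <= c) by apply m0_nonneg, HF.
  destruct Hc0 as [Hc0|<-]; [|lra].
  pose proof (char_lower_mass lam v G (c / 2) t K0 HF HC Hz Ht ltac:(fold c; lra)) as H.
  pose proof (clock_rate_ge lam v G 0 t HF HC Hl ltac:(lra)) as HG.
  destruct HC as (_ & HG0 & _). rewrite HG0 in HG. fold c in HG.
  set (y := t * c / 2).
  assert (Hy : 0 <= y) by (unfold y; nra).
  assert (Hg : gen (v 0) K0 (t * (c / 2) - G t) <= exp (- y) * C).
  { apply Rle_trans with (psum (fun k => exp (- y) * v 0 k) K0).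
    - apply psum_le. intros k Hk. rewrite Rmult_comm.
      apply Rmult_le_compat_r; [apply HF; lia|]. apply exp_monotone.
      assert (1 <= INR k) by (apply (le_INR 1); lia).
      assert (t * (c / 2) - G t <= - y) by (unfold y; lra). nra.
    - rewrite psum_scal. apply Rmult_le_compat_l; [left; apply exp_pos|].
      apply psum_le_m0, HF. }
  assert (He : exp (- y) * (1 + y) <= 1).
  { apply Rle_trans with (exp (- y) * exp y).
    - apply Rmult_le_compat_l; [left; apply exp_pos|apply exp_ineq1_le].
    - rewrite <- exp_plus, Rplus_opp_l, exp_0. lra. }
  assert (c / 2 * (1 + y) <= C).
  { apply Rle_trans with (exp (- y) * C * (1 + y)); [apply Rmult_le_compat_r; lra|].
    replace (exp (- y) * C * (1 + y)) with (exp (- y) * (1 + y) * C) by ring.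
    nra. }
  unfold y in *. nra.
Qed.

(** * Convergence *)

Definition zero_rate : R -> R := fun _ => 0.

(** With [H] the clock of [w], two comparisons give [G t <= H t <= G t + e * t]. The coefficients
    differ by the factor [exp (INR k * (G t - H t))], which lies between [1 - INR k * (e * t)] and
    1. *)
Lemma perturbation_bounds (lam : R -> R) (v w : R -> nat -> R) (G : R -> R) (e : R) :
  flow zero_rate v -> clock zero_rate v G -> flow lam w ->
  (forall t, 0 <= t -> 0 <= lam t <= e) ->
  (forall k, (1 <= k)%nat -> w 0 k = v 0 k) -> 0 < m0 (w 0) -> 0 <= e ->
  forall t, 0 <= t -> m0 (w t) <= m0 (v t) /\
    forall k, (1 <= k)%nat -> v t k - INR k * (e * t) * v t k <= w t k <= v t k.
Proof.
  intros HF HC HW Hl H0 Hm He t Ht.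
  destruct (clock_exists lam e w HW Hl Hm) as [H HH].
  assert (H1 : G t <= H t).
  { replace (H t) with (H t + 0 * t) by ring.
    apply (clock_compare zero_rate lam v w); try assumption; try lra.
    - intros k Hk. symmetry. apply H0, Hk.
    - intros s Hs. specialize (Hl s Hs). unfold zero_rate. lra. }
  assert (H2 : H t <= G t + e * t).
  { apply (clock_compare lam zero_rate w v); try assumption.
    intros s Hs. specialize (Hl s Hs). unfold zero_rate. lra. }
  split.
  - apply (mass_compare lam zero_rate w v H G); assumption.
  - intros k Hk. rewrite (tilted_transport lam zero_rate w v H G) by assumption.
    assert (Hv : 0 <= v t k) by (apply HF, Hk).
    pose proof (pos_INR k) as Hk0.
    assert (exp (INR k * (G t - H t)) <= 1).
    { rewrite <- exp_0. apply exp_monotone. nra. }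
    assert (1 - INR k * (e * t) <= exp (INR k * (G t - H t))).
    { pose proof (exp_ineq1_le (INR k * (G t - H t))). nra. }
    nra.
Qed.

(** Lower semicontinuity of a supremum of continuous partial sums; as the mass is antitone, this
    amounts to right continuity. *)
Lemma flow_mass_right (lam : R -> R) (v : R -> nat -> R) (s eps : R) :
  flow lam v -> 0 < eps -> exists d, 0 < d /\ m0 (v s) - eps < m0 (v (s + d)).
Proof.
  intros HF He.
  destruct (psum_near_m0 (v s) (m0 (v s) - eps / 2)) as [K HK]; [apply HF|lra|].
  specialize (HK K (le_n K)).
  assert (Hc : continuous (fun r => psum (v r) K) s).
  { apply (continuous_psum v). intros k Hk. apply HF; lia. }
  destruct (proj1 (continuous_Reps _ _) Hc (eps / 2)) as [d [Hd Hd']]; [lra|].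
  exists (d / 2). split; [lra|].
  specialize (Hd' (s + d / 2) ltac:(apply Rabs_def1; lra)). apply Rabs_def2 in Hd'.
  pose proof (psum_le_m0 (v (s + d / 2)) K ltac:(apply HF)). lra.
Qed.

Section Convergence.

Context (lam : nat -> R -> R) (v : R -> nat -> R) (w : nat -> R -> nat -> R) (K0 : nat)
  (Hlam0 : forall n t, 0 <= t -> 0 <= lam n t)
  (Hlam : forall eps, 0 < eps -> exists N : nat, forall n, (N <= n)%nat ->
            forall t, 0 <= t -> lam n t <= eps)
  (Hv : flow zero_rate v) (Hw : forall n, flow (lam n) (w n))
  (Hinit : forall n k, (1 <= k)%nat -> w n 0 k = v 0 k)
  (Hfin : forall k, (K0 < k)%nat -> v 0 k = 0)
  (Hpos : 0 < m0 (v 0)).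

Lemma initial_mass (n : nat) : m0 (w n 0) = m0 (v 0).
Proof. apply Series_ext. intros k. apply Hinit. lia. Qed.

Lemma critical_clock : exists G, clock zero_rate v G.
Proof.
  apply (clock_exists zero_rate 0); [exact Hv| |exact Hpos].
  intros t _. unfold zero_rate. lra.
Qed.

Lemma sequence_bounds (e : R) :
  0 < e -> exists N : nat, forall n, (N <= n)%nat -> forall t, 0 <= t ->
    m0 (w n t) <= m0 (v t) /\
    forall k, (1 <= k)%nat -> v t k - INR k * (e * t) * v t k <= w n t k <= v t k.
Proof.
  intros He. destruct critical_clock as [G HG]. destruct (Hlam e He) as [N HN].
  exists N. intros n Hn t Ht.
  apply (perturbation_bounds (lam n) v (w n) G e); try assumption; [apply Hw| | | |lra].
  - intros s Hs. split; [apply Hlam0, Hs|apply HN; assumption].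
  - apply Hinit.
  - rewrite initial_mass. exact Hpos.
Qed.

Lemma coefficients_converge (k : nat) (t : R) :
  0 <= t -> (1 <= k)%nat -> is_lim_seq (fun n => w n t k) (v t k).
Proof.
  intros Ht Hk. apply is_lim_seq_spec. intros eps.
  assert (Hv0 : 0 <= v t k) by (apply Hv, Hk).
  set (A := INR k * t * v t k).
  assert (HA : 0 <= A) by (pose proof (pos_INR k); repeat apply Rmult_le_pos; assumption).
  pose proof (cond_pos eps) as He.
  (* The [+ 1] keeps the quotient defined when [A = 0]; the resulting error is
     [eps * A / (2 * (A + 1)) < eps]. *)
  destruct (sequence_bounds (eps / (2 * (A + 1)))) as [N HN].
  { apply Rdiv_lt_0_compat; lra. }
  exists N. intros n Hn. destruct (HN n Hn t Ht) as [_ Hb]. specialize (Hb k Hk).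
  assert (Hsm : INR k * (eps / (2 * (A + 1)) * t) * v t k < eps).
  { replace (INR k * (eps / (2 * (A + 1)) * t) * v t k) with (eps * (A / (2 * (A + 1))))
      by (unfold A; field; fold A; lra).
    assert (A / (2 * (A + 1)) < 1).
    { apply Rmult_lt_reg_r with (2 * (A + 1)); [lra|].
      replace (A / (2 * (A + 1)) * (2 * (A + 1))) with A by (field; lra). lra. }
    nra. }
  apply Rabs_def1; lra.
Qed.

(** Only the lower bound is at stake, since [sequence_bounds] gives the upper one at all times at
    once. A partial sum carrying almost all of [m0 (v t)] converges term by term. *)
Lemma mass_converge (t eta : R) :
  0 <= t -> 0 < eta ->
  exists N : nat, forall n, (N <= n)%nat -> m0 (v t) - eta <= m0 (w n t).
Proof.
  intros Ht He.
  destruct (psum_near_m0 (v t) (m0 (v t) - eta / 2)) as [K HK]; [apply Hv|lra|].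
  specialize (HK K (le_n K)).
  assert (L : is_lim_seq (fun n => psum (w n t) K) (psum (v t) K)).
  { clear HK. induction K as [|K IH]; simpl; [apply is_lim_seq_const|].
    apply is_lim_seq_plus'; [exact IH|apply coefficients_converge; [exact Ht|lia]]. }
  apply is_lim_seq_spec in L.
  assert (He2 : 0 < eta / 2) by lra.
  destruct (L (mkposreal _ He2)) as [N HN]. exists N. intros n Hn.
  specialize (HN n Hn). simpl in HN. apply Rabs_def2 in HN.
  pose proof (psum_le_m0 (w n t) K ltac:(apply Hw)). lra.
Qed.

(* Polya's argument: pointwise convergence of monotone functions to a continuous
   monotone limit is uniform on compacts. *)
Lemma mass_converge_locally_uniformly (T eta : R) :
  0 <= T -> 0 < eta ->
  exists N : nat, forall n, (N <= n)%nat -> forall t, 0 <= t <= T ->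
    m0 (v t) - eta <= m0 (w n t).
Proof.
  intros HT He. destruct critical_clock as [G HG].
  assert (Hmv : forall s t, s <= t -> m0 (v t) <= m0 (v s)) by apply Hv.
  assert (Hmw : forall n s t, s <= t -> m0 (w n t) <= m0 (w n s)) by (intros n; apply Hw).
  (* Continuous induction on [T] takes the place of a finite subdivision of the interval. *)
  apply (real_induction (fun T => exists N : nat, forall n, (N <= n)%nat ->
    forall t, 0 <= t <= T -> m0 (v t) - eta <= m0 (w n t)) 0 T); [| |lra].
  - intros s Hs IH. destruct (Req_dec s 0) as [->|Hs0].
    + destruct (mass_converge 0 eta) as [N HN]; [lra|exact He|].
      exists N. intros n Hn t Ht. replace t with 0 by lra. apply HN, Hn.
    (* On [(q, s]] the limit mass varies by less than [eta / 2], so convergence at the right end [s]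
       controls the whole interval. *)
    + destruct (mass_left_continuous zero_rate v G K0 s (eta / 2)) as [q [Hq Hq']];
        try assumption; try lra; [intros; unfold zero_rate; lra|].
      destruct (IH q Hq) as [N1 HN1].
      destruct (mass_converge s (eta / 2)) as [N2 HN2]; [lra|lra|].
      exists (N1 + N2)%nat. intros n Hn t Ht.
      destruct (Rle_dec t q) as [Htq|Htq]; [apply HN1; [lia|lra]|].
      specialize (HN2 n ltac:(lia)). specialize (Hmw n t s ltac:(lra)).
      specialize (Hmv q t ltac:(lra)). lra.
  - intros s Hs IH. destruct (IH s ltac:(lra)) as [N1 HN1].
    (* The same argument on [(s, s + d]], where right continuity at [s] makes the variation
       small. *)
    destruct (flow_mass_right zero_rate v s (eta / 2) Hv) as [d [Hd Hd']]; [lra|].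
    destruct (mass_converge (s + d) (eta / 2)) as [N2 HN2]; [lra|lra|].
    exists d; split; [exact Hd|]. intros r Hr.
    exists (N1 + N2)%nat. intros n Hn t Ht.
    destruct (Rle_dec t s) as [Hts|Hts]; [apply HN1; [lia|lra]|].
    specialize (HN2 n ltac:(lia)). specialize (Hmw n t (s + d) ltac:(lra)).
    specialize (Hmv s t ltac:(lra)). lra.
Qed.

Lemma mass_converge_uniformly (eta : R) :
  0 < eta ->
  exists N : nat, forall n, (N <= n)%nat -> forall t, 0 <= t ->
    m0 (v t) - eta <= m0 (w n t) <= m0 (v t).
Proof.
  intros He. destruct critical_clock as [G HG].
  (* By [mass_decay] the limit mass is below [eta] from this time on, strictly because of the [+ 1];
     for large [n] both masses then lie in [[0, eta)]. *)
  set (T := 4 * m0 (v 0) / (eta * eta) + 1).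
  assert (HT : 0 < T).
  { assert (0 < 4 * m0 (v 0) / (eta * eta)) by (apply Rdiv_lt_0_compat; nra).
    unfold T. lra. }
  assert (HvT : m0 (v T) < eta).
  { apply Rnot_le_lt; intros Hle.
    pose proof (mass_decay zero_rate v G K0 T Hv HG
      ltac:(intros; unfold zero_rate; lra) Hfin ltac:(lra)) as Hdec.
    assert (eta * eta <= m0 (v T) * m0 (v T)) by (apply Rmult_le_compat; lra).
    assert (HeT : eta * eta * T = 4 * m0 (v 0) + eta * eta) by (unfold T; field; lra).
    assert (eta * eta * T <= m0 (v T) * m0 (v T) * T) by (apply Rmult_le_compat_r; lra).
    nra. }
  destruct (mass_converge_locally_uniformly T eta) as [N1 HN1]; [lra|exact He|].
  destruct (sequence_bounds 1 Rlt_0_1) as [N2 HN2].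
  exists (N1 + N2)%nat. intros n Hn t Ht. split; [|apply HN2; [lia|exact Ht]].
  destruct (Rle_dec t T) as [HtT|HtT]; [apply HN1; [lia|lra]|].
  pose proof (m0_nonneg (w n t) ltac:(apply Hw)).
  assert (m0 (v t) <= m0 (v T)) by (apply Hv; lra). lra.
Qed.

End Convergence.

Theorem theorem3
  (v0 : nat -> R) (lam : nat -> R -> R)
  (vn : nat -> R -> nat -> R) (v : R -> nat -> R) :
  in_Nstar v0 ->
  (forall n, continuous_on_halfline (lam n)) ->
  (forall n, exists c, 0 < c /\ forall t, 0 <= t -> c <= lam n t) ->
  (forall eps, 0 < eps -> exists N : nat, forall n, (N <= n)%nat ->
      forall t, 0 <= t -> Rabs (lam n t) < eps) ->
  (forall n, is_solution (lam n) v0 (vn n)) ->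
  is_solution (fun _ => 0) v0 v ->
  (forall t k, 0 <= t -> (1 <= k)%nat ->
      is_lim_seq (fun n => vn n t k) (v t k)) /\
  (forall eps, 0 < eps -> exists N : nat, forall n, (N <= n)%nat ->
      forall t, 0 <= t -> Rabs (Phi (vn n) t - Phi v t) < eps).
Proof.
  intros [_ [K0 HK0]] Hcont Hpos Hlim Hn Hs.
  set (V := fun s => v (Rmax 0 s)). set (W := fun n s => vn n (Rmax 0 s)).
  assert (EV : forall t, 0 <= t -> V t = v t).
  { intros t Ht. unfold V. rewrite Rmax_right by exact Ht. reflexivity. }
  assert (EW : forall n t, 0 <= t -> W n t = vn n t).
  { intros n t Ht. unfold W. rewrite Rmax_right by exact Ht. reflexivity. }
  assert (FV : flow zero_rate V).
  { apply (solution_flow zero_rate v0); [|exact Hs]. intros t Ht.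
    exact (filterlim_filter_le_1 _ (filter_le_within (fun s => 0 <= s))
             (filterlim_const (0 : R))). }
  assert (FW : forall n, flow (lam n) (W n)).
  { intros n. apply (solution_flow (lam n) v0); [apply Hcont|apply Hn]. }
  assert (Hl0 : forall n t, 0 <= t -> 0 <= lam n t).
  { intros n t Ht. destruct (Hpos n) as [c [Hc Hc']]. specialize (Hc' t Ht). lra. }
  assert (Hle : forall eps, 0 < eps -> exists N : nat, forall n, (N <= n)%nat ->
                  forall t, 0 <= t -> lam n t <= eps).
  { intros eps He. destruct (Hlim eps He) as [N HN]. exists N. intros n Hn' t Ht.
    specialize (HN n Hn' t Ht). apply Rabs_def2 in HN. lra. }
  assert (Hi : forall n k, (1 <= k)%nat -> W n 0 k = V 0 k).
  { intros n k Hk. rewrite EW, EV by lra. destruct Hs as (_ & Hs & _).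
    destruct (Hn n) as (_ & Hn' & _). rewrite Hs, Hn' by exact Hk. reflexivity. }
  assert (Hf : forall k, (S K0 <= k)%nat -> V 0 k = 0).
  { intros k Hk. rewrite EV by lra. destruct Hs as (_ & Hs & _).
    rewrite Hs by lia. apply HK0, Hk. }
  (* At [s = t = 0] the strict bound on [Phi] in [is_solution] excludes a vanishing initial mass. *)
  assert (Hp : 0 < m0 (V 0)).
  { rewrite EV by lra. destruct Hs as (_ & _ & _ & Hs).
    specialize (Hs 0 0 ltac:(lra) ltac:(lra)). lra. }
  split.
  - intros t k Ht Hk. rewrite <- EV by exact Ht.
    apply is_lim_seq_ext with (fun n => W n t k).
    + intros n. rewrite EW by exact Ht. reflexivity.
    + apply (coefficients_converge lam V W); assumption.
  - intros eps He.
    (* The initial masses agree, so the [Phi] differ exactly as the masses do; [eps / 2] turns weak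
       bounds into strict ones. *)
    destruct (mass_converge_uniformly lam V W K0 Hl0 Hle FV FW Hi Hf Hp (eps / 2))
      as [N HN]; [lra|].
    exists N. intros n Hn' t Ht. specialize (HN n Hn' t Ht).
    assert (E0 : m0 (W n 0) = m0 (V 0)) by (apply initial_mass; assumption).
    unfold Phi. rewrite <- (EW n 0), <- (EV 0), <- (EW n t), <- (EV t), E0 by lra.
    apply Rabs_def1; lra.
Qed.
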